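(* Let $M$ be a connected oriented smooth $4$-manifold with an $\mathrm{SU}(2)$-structure $(\omega_1,\omega_2,\omega_3)$, induced metric $g$ and torsion $1$-forms $a_1,a_2,a_3$. The traceless Ricci tensor of $g$ is $$\mathrm{Ric}_0(g)=P_1(\pi^2_-(\Phi_1))+P_2(\pi^2_-(\Phi_2))+P_3(\pi^2_-(\Phi_3))\in\Sigma^2_{0,1}(M)\oplus\Sigma^2_{0,2}(M)\oplus\Sigma^2_{0,3}(M),$$ where $$\Phi_1:=da_1+\tfrac14\big(J_2a_2\wedge J_2a_3-J_1a_1\wedge J_2a_3+J_2a_2\wedge a_1\big)-\tfrac14\big(J_1a_1\wedge J_3a_2+J_3a_3\wedge a_1\big)-\tfrac34\,J_3a_3\wedge J_3a_2,$$ and $\Phi_2,\Phi_3$ are obtained from $\Phi_1$ by cyclically permuting the indices $(1,2,3)$. The scalar curvature is $$\mathrm{Scal}(g)=-2\Big(\sum_{i=1}^3g(da_i,\omega_i)+g(J_1a_1,J_2a_2)+g(J_1a_1,J_3a_3)+g(J_2a_2,J_3a_3)\Big).$$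
   Context: An $\mathrm{SU}(2)$-structure on a connected oriented $4$-manifold $M$ is a triple $(\omega_1,\omega_2,\omega_3)$ of $2$-forms such that near each point there is a local coframe $e^1,\dots,e^4$ with $\omega_1=e^{12}+e^{34}$, $\omega_2=e^{13}+e^{42}$, $\omega_3=e^{14}+e^{23}$ ($e^{ij}=e^i\wedge e^j$). It determines the metric $g=\sum_i e^i\otimes e^i$, the volume form $e^{1234}$, the Hodge star $*$, the Levi-Civita connection $\nabla$, and almost complex structures $J_i$ by $\omega_i(X,Y)=g(J_iX,Y)$. On $1$-forms, $(J_i\alpha)(X)=\alpha(J_iX)$. Inner products of $k$-forms are normalised so that $|e^{i_1\dots i_k}|=1$ (so $g(\omega_i,\omega_j)=2\delta_{ij}$). Torsion $1$-forms: $a_1,a_2,a_3$ are the unique $1$-forms with $\nabla_X\omega_1=a_3(X)\omega_2-a_2(X)\omega_3$, $\nabla_X\omega_2=a_1(X)\omega_3-a_3(X)\omega_1$, $\nabla_X\omega_3=a_2(X)\omega_1-a_1(X)\omega_2$. $\pi^2_-(\alpha)=\tfrac12(\alpha-*\alpha)$ is the projection of $2$-forms to anti-self-dual forms $\Lambda^2_-(M)$. $\Sigma^2_{0,i}(M)$ is the space of symmetric $2$-tensors $\beta$ with $\beta(J_i\cdot,J_i\cdot)=\beta$ and $\beta(J_l\cdot,J_l\cdot)=-\beta$ for $l\ne i$. $P_i:\Lambda^2_-(M)\to\Sigma^2_{0,i}(M)$ is given by $P_i(\alpha)(X,Y)=\alpha(J_iX,Y)$. *)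

(* Defs.v *)
From mathcomp Require Import all_boot all_order all_algebra.
From mathcomp Require Import all_classical all_reals all_analysis.

Set Implicit Arguments.
Unset Strict Implicit.
Unset Printing Implicit Defensive.

Import Order.TTheory GRing.Theory Num.Theory.
Import numFieldNormedType.Exports.

Local Open Scope classical_set_scope.
Local Open Scope ring_scope.

Definition pderiv (R : realType) (n : nat) (V : normedModType R) (i : 'I_n)
    (f : 'rV[R]_n -> V) : 'rV[R]_n -> V :=
  fun x => 'D_(delta_mx 0 i) f x.

(* All iterated partial derivatives of all orders are differentiable; for an
   open [U] this is C^oo. *)
Definition smooth_on (R : realType) (n : nat) (V : normedModType R)
    (U : set 'rV[R]_n) (f : 'rV[R]_n -> V) : Prop :=
  forall (s : seq 'I_n) (x : 'rV[R]_n), U x ->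
    differentiable (foldr (@pderiv R n V) f s) x.

(* A homeomorphism [coord], with inverse [param], from an open subset of [M]
   onto an open subset of R^n; both maps have junk values elsewhere. *)
Record chart (R : realType) (n : nat) (M : topologicalType) := Chart {
  cdom : set M;
  cimg : set 'rV[R]_n;
  coord : M -> 'rV[R]_n;
  param : 'rV[R]_n -> M;
  cdom_open : open cdom;
  cimg_open : open cimg;
  coord_cimg : forall p, cdom p -> cimg (coord p);
  param_cdom : forall x, cimg x -> cdom (param x);
  coordK : forall p, cdom p -> param (coord p) = p;
  paramK : forall x, cimg x -> coord (param x) = x;
  coord_continuous : {within cdom, continuous coord};
  param_continuous : {within cimg, continuous param} }.

Definition overlap (R : realType) (n : nat) (M : topologicalType)
    (c d : chart R n M) : set 'rV[R]_n :=
  [set x | cimg c x /\ cdom d (param c x)].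

Definition transition (R : realType) (n : nat) (M : topologicalType)
    (c d : chart R n M) : 'rV[R]_n -> 'rV[R]_n :=
  fun x => coord d (param c x).

Record smooth_manifold (R : realType) (n : nat) := SmoothManifold {
  carrier :> topologicalType;
  chart_index : Type;
  atlas : chart_index -> chart R n carrier;
  manifold_hausdorff : hausdorff_space carrier;
  manifold_second_countable : @second_countable carrier;
  atlas_cover : forall p : carrier, exists c, cdom (atlas c) p;
  atlas_smooth : forall c d,
    smooth_on (overlap (atlas c) (atlas d)) (transition (atlas c) (atlas d)) }.

(* The orientation of a manifold is given by an atlas all of whose transition
   maps preserve the orientation of R^n. *)
Definition oriented (R : realType) (n : nat) (M : smooth_manifold R n) : Prop :=
  forall (c d : chart_index M) (x : 'rV[R]_n),
    overlap (atlas c) (atlas d) x ->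
    0 < \det (jacobian (transition (atlas c) (atlas d)) x).

(* A tensor field is given by its components in each chart: a 1-form [al] by
   the row of the [al(d_j)], a covariant 2-tensor [B] by the matrix of the
   [B(d_i, d_j)]. As [jacobian f x] acts on row vectors from the right, its
   entry (i, j) is [d_i f_j]. *)

Record one_form (R : realType) (n : nat) (M : smooth_manifold R n) := OneForm {
  one_comp :> chart_index M -> 'rV[R]_n -> 'rV[R]_n;
  one_smooth : forall c, smooth_on (cimg (atlas c)) (one_comp c);
  one_transform : forall c d x, overlap (atlas c) (atlas d) x ->
    let f := transition (atlas c) (atlas d) in
    one_comp c x = one_comp d (f x) *m (jacobian f x)^T }.

Record two_form (R : realType) (n : nat) (M : smooth_manifold R n) := TwoForm {
  two_comp :> chart_index M -> 'rV[R]_n -> 'M[R]_n;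
  two_smooth : forall c, smooth_on (cimg (atlas c)) (two_comp c);
  two_antisym : forall c x, cimg (atlas c) x ->
    (two_comp c x)^T = - two_comp c x;
  two_transform : forall c d x, overlap (atlas c) (atlas d) x ->
    let f := transition (atlas c) (atlas d) in
    two_comp c x = jacobian f x *m two_comp d (f x) *m (jacobian f x)^T }.

(* Tangent vectors are rows; a row [X] is mapped to [X *m A] by the
   endomorphism with matrix [A]. *)

Definition k1 : 'I_3 := 0.
Definition k2 : 'I_3 := 1.
Definition k3 : 'I_3 := 2.

Section Pointwise.
Variable R : realType.
Implicit Types (al be X : 'rV[R]_4) (A B E : 'M[R]_4).

Definition pairing al X : R := (X *m al^T) 0 0.

(* (al /\ be)(X, Y) = al(X) be(Y) - al(Y) be(X) *)
Definition wedge al be : 'M[R]_4 := al^T *m be - be^T *m al.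

(* The rows 0, 1, 2, 3 of [E] are the 1-forms e^1, e^2, e^3, e^4. *)
Definition su2_coframe (W : 'I_3 -> 'M[R]_4) E : Prop :=
  [/\ E \in unitmx,
      W k1 = wedge (row 0 E) (row 1 E) + wedge (row 2 E) (row 3 E),
      W k2 = wedge (row 0 E) (row 2 E) + wedge (row 3 E) (row 1 E)
    & W k3 = wedge (row 0 E) (row 3 E) + wedge (row 1 E) (row 2 E)].

Variable W : 'I_3 -> 'M[R]_4.

(* Two coframes adapted to [W] differ by an element of SU(2), so the metric and
   the volume form below do not depend on the chosen one. *)
Definition some_coframe : 'M[R]_4 := xget 0 [set E | su2_coframe W E].

(* g = \sum_i e^i (x) e^i *)
Definition metric : 'M[R]_4 :=
  \sum_(i < 4) (row i some_coframe)^T *m row i some_coframe.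

(* e^{1234}(d_i, d_j, d_k, d_l) *)
Definition volume (i j k l : 'I_4) : R :=
  \det (\matrix_(p < 4, q < 4) some_coframe p (tnth [tuple i; j; k; l] q)).

(* omega_i(X, Y) = g(J_i X, Y), i.e. W_i = J_i *m g. *)
Definition Jmx (i : 'I_3) : 'M[R]_4 := W i *m invmx metric.

(* (J_i al)(X) = al(J_i X) *)
Definition Jform (i : 'I_3) al : 'rV[R]_4 := al *m (Jmx i)^T.

Definition inner1 al be : R := (al *m invmx metric *m be^T) 0 0.

(* The factor 1/2 gives |e^{ij}| = 1. *)
Definition inner2 A B : R :=
  2^-1 * \sum_(i < 4) \sum_(j < 4) \sum_(p < 4) \sum_(q < 4)
    invmx metric i p * invmx metric j q * A i j * B p q.

(* ( * A)_{kl} = 1/2 A^{ij} vol_{ijkl} *)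
Definition hodge A : 'M[R]_4 :=
  \matrix_(k < 4, l < 4) (2^-1 * \sum_(i < 4) \sum_(j < 4)
    (invmx metric *m A *m (invmx metric)^T) i j * volume i j k l).

Definition asd_proj A : 'M[R]_4 := 2^-1 *: (A - hodge A).

(* P_i(A)(X, Y) = A(J_i X, Y) *)
Definition Pmap (i : 'I_3) A : 'M[R]_4 := Jmx i *m A.

Definition in_Sigma0 (i : 'I_3) B : Prop :=
  [/\ B^T = B,
      Jmx i *m B *m (Jmx i)^T = B
    & forall l : 'I_3, l != i -> Jmx l *m B *m (Jmx l)^T = - B].

End Pointwise.

Section Local.
Variable R : realType.

(* (da)_{ij} = d_i a_j - d_j a_i *)
Definition ext_deriv (a : 'rV[R]_4 -> 'rV[R]_4) (x : 'rV[R]_4) : 'M[R]_4 :=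
  \matrix_(i < 4, j < 4)
    (pderiv i (fun y => a y 0 j) x - pderiv j (fun y => a y 0 i) x).

Section LeviCivita.
Variable g : 'rV[R]_4 -> 'M[R]_4.

(* \nabla_{d_i} d_j = \sum_k christoffel k i j d_k *)
Definition christoffel (k i j : 'I_4) (x : 'rV[R]_4) : R :=
  2^-1 * \sum_(l < 4) invmx (g x) k l *
    (pderiv i (fun y => g y j l) x + pderiv j (fun y => g y i l) x
     - pderiv l (fun y => g y i j) x).

(* \nabla_X B for a covariant 2-tensor field B *)
Definition nabla (X : 'rV[R]_4) (B : 'rV[R]_4 -> 'M[R]_4) (x : 'rV[R]_4) :
    'M[R]_4 :=
  \matrix_(i < 4, j < 4) \sum_(k < 4) X 0 k *
    (pderiv k (fun y => B y i j) x
     - \sum_(l < 4) christoffel l k i x * B x l j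
     - \sum_(l < 4) christoffel l k j x * B x i l).

(* R(d_i, d_j) d_k = \sum_l riemann l k i j d_l,
   with R(X, Y) = [\nabla_X, \nabla_Y] - \nabla_[X, Y] *)
Definition riemann (l k i j : 'I_4) (x : 'rV[R]_4) : R :=
  pderiv i (christoffel l j k) x - pderiv j (christoffel l i k) x
  + \sum_(m < 4) (christoffel l i m x * christoffel m j k x
                  - christoffel l j m x * christoffel m i k x).

(* Ric(Y, Z) = tr (X |-> R(X, Y) Z) *)
Definition ricci (x : 'rV[R]_4) : 'M[R]_4 :=
  \matrix_(j < 4, k < 4) \sum_(i < 4) riemann i k i j x.

Definition scal (x : 'rV[R]_4) : R :=
  \sum_(j < 4) \sum_(k < 4) invmx (g x) j k * ricci x j k.

Definition ricci0 (x : 'rV[R]_4) : 'M[R]_4 :=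
  ricci x - (scal x / 4) *: g x.

End LeviCivita.

Variables (w : 'I_3 -> 'rV[R]_4 -> 'M[R]_4) (a : 'I_3 -> 'rV[R]_4 -> 'rV[R]_4).

Definition metric_field (x : 'rV[R]_4) : 'M[R]_4 := metric (fun i => w i x).

Definition torsion_eqs (x : 'rV[R]_4) : Prop :=
  forall X : 'rV[R]_4,
    [/\ nabla metric_field X (w k1) x
          = pairing (a k3 x) X *: w k2 x - pairing (a k2 x) X *: w k3 x,
        nabla metric_field X (w k2) x
          = pairing (a k1 x) X *: w k3 x - pairing (a k3 x) X *: w k1 x
      & nabla metric_field X (w k3) x
          = pairing (a k2 x) X *: w k1 x - pairing (a k1 x) X *: w k2 x].

(* [Phi k1 k2 k3] is Phi_1; the other two are its cyclic permutations. *)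
Definition Phi (i j k : 'I_3) (x : 'rV[R]_4) : 'M[R]_4 :=
  let J l al := Jform (fun m => w m x) l al in
  ext_deriv (a i) x
  + 4^-1 *: (wedge (J j (a j x)) (J j (a k x))
             - wedge (J i (a i x)) (J j (a k x))
             + wedge (J j (a j x)) (a i x))
  - 4^-1 *: (wedge (J i (a i x)) (J k (a j x)) + wedge (J k (a k x)) (a i x))
  - (3 / 4) *: wedge (J k (a k x)) (J k (a j x)).

Definition Ric0_part (i j k : 'I_3) (x : 'rV[R]_4) : 'M[R]_4 :=
  let W m := w m x in Pmap W i (asd_proj W (Phi i j k x)).

End Local.

(* Near each point, in every chart around it, there is a smooth coframe in
   which the forms take the standard shape. *)
Definition su2_structure (R : realType) (M : smooth_manifold R 4)
    (w : 'I_3 -> two_form M) : Prop :=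
  forall (c : chart_index M) (x : 'rV[R]_4), cimg (atlas c) x ->
    exists (U : set 'rV[R]_4) (E : 'rV[R]_4 -> 'M[R]_4),
      [/\ open U, U x, U `<=` cimg (atlas c), smooth_on U E
        & forall y, U y -> su2_coframe (fun i => w i c y) (E y)].

Definition torsion_forms (R : realType) (M : smooth_manifold R 4)
    (w : 'I_3 -> two_form M) (a : 'I_3 -> one_form M) : Prop :=
  forall (c : chart_index M) (x : 'rV[R]_4), cimg (atlas c) x ->
    torsion_eqs (fun i => w i c) (fun i => a i c) x.

(* Main.v *)
Require Import Defs.
From mathcomp Require Import all_boot all_order all_algebra.
From mathcomp Require Import all_classical all_reals all_analysis.
From mathcomp Require Import ring lra.
Import Order.TTheory GRing.Theory Num.Theory.
Import numFieldNormedType.Exports.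
Local Open Scope classical_set_scope.
Local Open Scope ring_scope.

Set Implicit Arguments.
Unset Strict Implicit.
Unset Printing Implicit Defensive.

(** The idea. The forms W_1, W_2, W_3 trivialise the bundle of self-dual
2-forms, and the torsion forms are the connection matrix of the Levi-Civita
connection in this trivialisation. Its curvature matrix has the entries
F_i = da_i + a_j /\ a_k, for (i, j, k) cyclic, so the Ricci identity applied to
W_i expresses the commutators of the Riemann curvature R with the almost
complex structures: [R, J_i] = F_j J_k - F_k J_j, as matrices acting on rows
([curvature_of_rotating_form], which rests on [ricci_identity] and on the
symmetry of second derivatives [derive_comm]).

These commutators alone determine the Ricci tensor. Contracting R J_1 and using
the first Bianchi identity and the symmetries of R gives a multiple of the
trace of R J_1, and that trace is read off from the commutator with J_2. The
outcome is Ric = - \sum_i F_i J_i^T ([ricci_of_quaternionic_curvature]), which is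
also \sum_i J_i F_i since Ric is symmetric.

What remains is algebra in one tangent space. An antisymmetric F is the sum of
its anti-self-dual part and of \sum_l f_l W_l with f_l = g(F, W_l) / 2. Since
J_i W_i = - g while J_i W_l = +- W_m is antisymmetric for l <> i, the symmetric
part of J_i F_i is P_i of the anti-self-dual part of F_i, minus f_i g
([symmetric_part]). Hence Ric = \sum_i P_i(F_i^-) - (\sum_i f_i) g; the first sum is
traceless, and both claims follow once F_i is compared with Phi_i.

The comparison uses that the anti-self-dual part of F is its average
(F + \sum_l J_l F J_l^T) / 4 under the quaternion group ([asd_proj_avg]). In
particular al /\ be and J_l al /\ J_l be have the same anti-self-dual part, so in
Phi_1 the terms a_1 /\ J_2 a_2 and a_1 /\ J_3 a_3 cancel in pairs, and the other
quadratic terms add up to (1/4 + 3/4) a_2 /\ a_3 ([avg_torsion_two_form]). In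
the scalar curvature g(a_j /\ a_k, W_i) is rewritten as g(J_j a_j, J_k a_k),
because J_j J_k = - J_i as matrices acting on rows ([inner2_wedge]).

In matrix terms: a row X is sent to X *m J by the endomorphism J, so composition
of endomorphisms is the reversed matrix product and J_1 *m J_2 = - J_3. *)

(** * Symmetry of second derivatives *)

Section Schwarz.
Variables (R : realType) (V : normedModType R).
Implicit Types (f : V -> R) (x u v : V).

Lemma differential_approx f x (e : R) : differentiable f x -> 0 < e ->
  exists2 d : R, 0 < d &
    forall h, `|h| < d -> `|f (x + h) - f x - 'd f x h| <= e * `|h|.
Proof.
move=> /diff_locally /eqaddoP df e0.
have /nbhs_ballP[d d0 hd] := df _ e0; exists d => // h hlt.
have := hd h; rewrite -ball_normE /= sub0r normrN => /(_ hlt).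
by rewrite !fctE opprD addrA [h + x]addrC.
Qed.

Lemma is_derive_line f x v (t : R) : differentiable f (x + t *: v) ->
  is_derive t 1 (fun s : R => f (x + s *: v)) ('D_v f (x + t *: v)).
Proof.
move=> df.
have E : (fun h : R => h^-1 *:
      (((fun s : R => f (x + s *: v)) \o shift t) (h *: 1) - f (x + t *: v)))
    = (fun h : R => h^-1 *: ((f \o shift (x + t *: v)) (h *: v) - f (x + t *: v))).
  by apply/funext => h /=; rewrite [_ *: 1]mulr1 addrCA -scalerDl.
apply: DeriveDef; first by rewrite /derivable E; exact: diff_derivable.
by rewrite /derive E.
Qed.

(** The mean value theorem in the direction [u] turns the second difference
into a first difference of ['D_u f], and differentiability of ['D_u f] at the one
point [x] controls that. The estimate is not symmetric in [u] and [v], the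
second difference is; this yields [derive_comm]. *)
Lemma second_difference_approx f x u v (e : R) :
    (\forall y \near x, differentiable f y) -> differentiable ('D_u f) x ->
    0 < e ->
  exists2 d : R, 0 < d & forall t : R, 0 < t < d ->
    `|f (x + t *: v + t *: u) - f (x + t *: v) - (f (x + t *: u) - f x)
      - t ^+ 2 * 'D_v ('D_u f) x| <= e * t ^+ 2.
Proof.
move=> fnear ddf e0.
pose k : R := `|u| + `|v| + 1.
have k0 : 0 < k by rewrite ltr_wpDl // addr_ge0.
have [d1 d10 hd1] : exists2 d : R, 0 < d &
    forall h, `|h| < d -> differentiable f (x + h).
  have /nbhs_ballP[d d0 hd] := fnear; exists d => // h hlt.
  by apply: hd; rewrite -ball_normE /= opprD addNKr normrN.
have [d2 d20 hd2] := differential_approx ddf (divr_gt0 e0 (mulr_gt0 (ltr0n R 2) k0)).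
(* The displacements s v + r u with s, r in [0, t] have norm at most t k. *)
pose d := Num.min d1 d2 / k.
have d0 : 0 < d by rewrite divr_gt0 // lt_min d10.
exists d => // t /andP[t0 td].
have tk : t * k < Num.min d1 d2 by rewrite -ltr_pdivlMr.
have small (r s : R) : 0 <= r <= t -> 0 <= s <= t ->
    `|s *: v + r *: u| <= t * k.
  move=> /andP[r0 rt] /andP[s0 st].
  apply: le_trans (ler_normD _ _) _; rewrite !normrZ !ger0_norm // /k !mulrDr.
  have := ler_wpM2r (normr_ge0 u) rt; have := ler_wpM2r (normr_ge0 v) st.
  by rewrite mulr1; lra.
pose phi s := f (x + t *: v + s *: u) - f (x + s *: u).
pose dphi s := 'D_u f (x + t *: v + s *: u) - 'D_u f (x + s *: u).
have diffs (r s : R) : 0 <= r <= t -> 0 <= s <= t ->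
    differentiable f (x + s *: v + r *: u).
  move=> rt st; rewrite -addrA; apply: hd1; apply: le_lt_trans (small _ _ rt st) _.
  by move: tk; rewrite lt_min => /andP[].
have tt : 0 <= t <= t by rewrite lexx ltW.
have t00 : (0 : R) <= 0 <= t by rewrite lexx ltW.
have phiD s : 0 <= s <= t -> is_derive s 1 phi (dphi s).
  move=> st; apply: is_deriveB.
    by apply: is_derive_line; exact: diffs.
  by apply: is_derive_line; have := diffs _ _ st t00; rewrite scale0r addr0.
have [th thI phith] : exists2 c, c \in `]0, t[%R & phi t - phi 0 = dphi c * (t - 0).
  apply: MVT => //.
    by move=> s; rewrite in_itv /= => /andP[s0 st]; apply: phiD; rewrite !ltW.
  apply: derivable_within_continuous => s; rewrite in_itv /= => st.
  by have [] := phiD _ st.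
have tht : 0 <= th <= t by move: thI; rewrite in_itv /= => /andP[? ?]; rewrite !ltW.
have a1 := hd2 (t *: v + th *: u).
have a2 := hd2 (0 *: v + th *: u).
have lt2 (s : R) : 0 <= s <= t -> `|s *: v + th *: u| < d2.
  move=> st; apply: le_lt_trans (small _ _ tht st) _.
  by move: tk; rewrite lt_min => /andP[].
have {}a1 := a1 (lt2 _ tt); have {}a2 := a2 (lt2 _ t00).
have e2k : e / (2 * k) * (t * k) = e * t / 2 by field; rewrite gt_eqF.
have ek0 : 0 <= e / (2 * k) by rewrite ltW // divr_gt0 // mulr_gt0.
have b1 := le_trans a1 (ler_wpM2l ek0 (small _ _ tht tt)).
have b2 := le_trans a2 (ler_wpM2l ek0 (small _ _ tht t00)).
rewrite e2k in b1 b2.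
have -> : f (x + t *: v + t *: u) - f (x + t *: v) - (f (x + t *: u) - f x)
    = phi t - phi 0 by rewrite /phi scale0r !addr0; ring.
rewrite phith subr0 deriveE //.
set lv := 'd ('D_u f) x v; set lu := 'd ('D_u f) x u.
have dE (s : R) : 'd ('D_u f) x (s *: v + th *: u) = s * lv + th * lu.
  by rewrite linearD !linearZ.
move: b1 b2; rewrite !dE scale0r mul0r !add0r addrA.
set p := 'D_u f _; set q := 'D_u f x; set r := 'D_u f _ => b1 b2.
have -> : dphi th * t - t ^+ 2 * lv =
    t * ((p - q - (t * lv + th * lu)) - (r - q - th * lu)).
  by rewrite /dphi -/p -/r; ring.
rewrite normrM gtr0_norm // expr2 mulrCA ler_pM2l //.
apply: le_trans (ler_normB _ _) _; apply: le_trans (lerD b1 b2) _.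
by rewrite -splitr.
Qed.

Lemma derive_comm f x u v :
    (\forall y \near x, differentiable f y) ->
    differentiable ('D_u f) x -> differentiable ('D_v f) x ->
  'D_u ('D_v f) x = 'D_v ('D_u f) x.
Proof.
move=> fnear du dv; apply/eqP; rewrite -subr_eq0 -normr_le0.
apply/ler_addgt0Pr => e e0; rewrite add0r.
have e20 : 0 < e / 2 by rewrite divr_gt0.
have [d1 d10 h1] := second_difference_approx v fnear du e20.
have [d2 d20 h2] := second_difference_approx u fnear dv e20.
pose t := Num.min d1 d2 / 2.
have m0 : 0 < Num.min d1 d2 by rewrite lt_min d10.
have t0 : 0 < t by rewrite divr_gt0.
have tm : t < Num.min d1 d2 by rewrite /t; lra.
move: tm; rewrite lt_min => /andP[t1 t2].
have {}h1 := h1 t; rewrite t0 t1 in h1; have {}h1 := h1 isT.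
have {}h2 := h2 t; rewrite t0 t2 in h2; have {}h2 := h2 isT.
rewrite (addrAC x (t *: u)) in h2.
set A := f _ in h1 h2; set B := f _ in h1 h2; set C := f _ in h1 h2.
rewrite -(ler_pM2l (exprn_gt0 2 t0)) -[t ^+ 2 in leLHS]gtr0_norm ?exprn_gt0 //.
rewrite -normrM.
set P := 'D_u ('D_v f) x in h2 *; set Q := 'D_v ('D_u f) x in h1 *.
have -> : t ^+ 2 * (P - Q) =
   (A - B - (C - f x) - t ^+ 2 * Q) - (A - C - (B - f x) - t ^+ 2 * P) by ring.
apply: le_trans (ler_normB _ _) _; apply: le_trans (lerD h1 h2) _.
by rewrite -mulrDl -splitr mulrC.
Qed.

End Schwarz.

(** * Entrywise calculus of matrix-valued functions *)

Section Locality.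
Variables (R : realType) (V W : normedModType R).

Lemma near_eq_differentiable (f h : V -> W) (x : V) :
  (\near x, f x = h x) -> differentiable f x -> differentiable h x.
Proof.
move=> fh /diff_locallyP [dc /eqaddoP df].
have hE : h \o shift x = cst (h x) + 'd f x +o_ 0 id.
  apply/eqaddoP => e e0; have fh0 : \forall y \near (0 : V), f (y + x) = h (y + x).
    by have := fh; rewrite (near_shift 0 x) /= subr0.
  near=> y; rewrite !fctE -(nbhs_singleton fh).
  have -> : h (shift x y) = f (shift x y) by symmetry; near: y.
  by near: y; exact: (df e e0).
by apply/diff_locallyP; rewrite (diff_unique dc hE).
Unshelve. all: by end_near. Qed.

Lemma open_near (U : set V) (x : V) (P : V -> Prop) :
  open U -> U x -> (forall y, U y -> P y) -> \forall y \near x, P y.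
Proof. by move=> oU Ux UP; apply: filterS UP _; exact: open_nbhs_nbhs. Qed.

End Locality.

Section Entries.
Variables (V : zmodType) (m n : nat).
Implicit Types (A B : 'M[V]_(m, n)).

Lemma entryD A B i j : (A + B) i j = A i j + B i j.
Proof. by rewrite mxE. Qed.

Lemma entryB A B i j : (A - B) i j = A i j - B i j.
Proof. by rewrite !mxE. Qed.

End Entries.

Section MatrixCalculus.
Variables (R : realType) (n : nat).
Implicit Types (x y : 'rV[R]_n) (U : set 'rV[R]_n) (k l : 'I_n).

Definition mx_diff p q (B : 'rV[R]_n -> 'M[R]_(p, q)) x : Prop :=
  forall i j, differentiable (fun y => B y i j) x.

Definition mx_pderiv p q k (B : 'rV[R]_n -> 'M[R]_(p, q)) x : 'M[R]_(p, q) :=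
  \matrix_(i, j) pderiv k (fun y => B y i j) x.

Lemma mx_pderivE p q k (B : 'rV[R]_n -> 'M[R]_(p, q)) x i j :
  mx_pderiv k B x i j = pderiv k (fun y => B y i j) x.
Proof. by rewrite mxE. Qed.

Lemma pderivD k (f h : 'rV[R]_n -> R) x :
  differentiable f x -> differentiable h x ->
  pderiv k (fun y => f y + h y) x = pderiv k f x + pderiv k h x.
Proof. by move=> df dh; rewrite /pderiv -deriveD //; exact: diff_derivable. Qed.

Lemma pderivM k (f h : 'rV[R]_n -> R) x :
  differentiable f x -> differentiable h x ->
  pderiv k (fun y => f y * h y) x = pderiv k f x * h x + f x * pderiv k h x.
Proof.
move=> df dh; have := @deriveM R _ f h x (delta_mx 0 k).
rewrite /pderiv => -> //; try exact: diff_derivable.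
by rewrite addrC /GRing.scale /= [h x * _]mulrC.
Qed.

Lemma differentiable_bigsum (I : Type) (r : seq I) (P : pred I)
    (F : I -> 'rV[R]_n -> R) x : (forall i, differentiable (F i) x) ->
  differentiable (fun y => \sum_(i <- r | P i) F i y) x.
Proof.
move=> dF; elim: r => [|i r IHr].
  under eq_fun do rewrite big_nil; exact: differentiable_cst.
under eq_fun do rewrite big_cons; case: (P i) => //; exact: differentiableD.
Qed.

Lemma differentiable_bigprod (I : Type) (r : seq I) (P : pred I)
    (F : I -> 'rV[R]_n -> R) x : (forall i, differentiable (F i) x) ->
  differentiable (fun y => \prod_(i <- r | P i) F i y) x.
Proof.
move=> dF; elim: r => [|i r IHr].
  under eq_fun do rewrite big_nil; exact: differentiable_cst.
under eq_fun do rewrite big_cons; case: (P i) => //; exact: differentiableM.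
Qed.

Lemma pderiv_bigsum k (I : Type) (r : seq I) (P : pred I)
    (F : I -> 'rV[R]_n -> R) x : (forall i, differentiable (F i) x) ->
  pderiv k (fun y => \sum_(i <- r | P i) F i y) x
    = \sum_(i <- r | P i) pderiv k (F i) x.
Proof.
move=> dF; elim: r => [|i r IHr].
  rewrite big_nil; under eq_fun do rewrite big_nil.
  by rewrite /pderiv derive_cst.
rewrite big_cons; under eq_fun do rewrite big_cons.
case: (P i) => //; rewrite -IHr pderivD //; exact: differentiable_bigsum.
Qed.

Lemma eq_on_mx_pderiv U p q (A B : 'rV[R]_n -> 'M[R]_(p, q)) k x :
  open U -> U x -> (forall y, U y -> A y = B y) ->
  mx_pderiv k A x = mx_pderiv k B x.
Proof.
move=> oU Ux AB; apply/matrixP => i j; rewrite !mxE; apply: near_eq_derive.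
by apply: (open_near oU Ux) => y Uy; rewrite AB.
Qed.

Lemma eq_on_mx_diff U p q (A B : 'rV[R]_n -> 'M[R]_(p, q)) x :
  open U -> U x -> (forall y, U y -> A y = B y) -> mx_diff A x -> mx_diff B x.
Proof.
move=> oU Ux AB dA i j; apply: near_eq_differentiable (dA i j).
by apply: (open_near oU Ux) => y Uy; rewrite AB.
Qed.

Lemma mx_diffD p q (A B : 'rV[R]_n -> 'M[R]_(p, q)) x :
  mx_diff A x -> mx_diff B x -> mx_diff (fun y => A y + B y) x.
Proof.
by move=> dA dB i j; under eq_fun do rewrite mxE; exact: differentiableD.
Qed.

Lemma mx_pderivD p q (A B : 'rV[R]_n -> 'M[R]_(p, q)) k x :
  mx_diff A x -> mx_diff B x ->
  mx_pderiv k (fun y => A y + B y) x = mx_pderiv k A x + mx_pderiv k B x.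
Proof.
move=> dA dB; apply/matrixP => i j; rewrite !mxE.
by under eq_fun do rewrite mxE; exact: pderivD.
Qed.

Lemma mx_diffM p q r (A : 'rV[R]_n -> 'M[R]_(p, q))
    (B : 'rV[R]_n -> 'M[R]_(q, r)) x :
  mx_diff A x -> mx_diff B x -> mx_diff (fun y => A y *m B y) x.
Proof.
move=> dA dB i j; under eq_fun do rewrite mxE.
by apply: differentiable_bigsum => l; exact: differentiableM.
Qed.

Lemma mx_pderivM p q r (A : 'rV[R]_n -> 'M[R]_(p, q))
    (B : 'rV[R]_n -> 'M[R]_(q, r)) k x :
  mx_diff A x -> mx_diff B x ->
  mx_pderiv k (fun y => A y *m B y) x
    = mx_pderiv k A x *m B x + A x *m mx_pderiv k B x.
Proof.
move=> dA dB; apply/matrixP => i j; rewrite !mxE -big_split /=.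
under eq_fun do rewrite mxE.
rewrite pderiv_bigsum => [|l]; last exact: differentiableM.
by apply: eq_bigr => l _; rewrite pderivM // !mxE.
Qed.

Lemma mx_diffT p q (A : 'rV[R]_n -> 'M[R]_(p, q)) x :
  mx_diff A x -> mx_diff (fun y => (A y)^T) x.
Proof. by move=> dA i j; under eq_fun do rewrite mxE; exact: dA. Qed.

Lemma mx_pderivT p q (A : 'rV[R]_n -> 'M[R]_(p, q)) k x :
  mx_pderiv k (fun y => (A y)^T) x = (mx_pderiv k A x)^T.
Proof.
by apply/matrixP => i j; rewrite !mxE; under eq_fun do rewrite mxE.
Qed.

Lemma mx_diffZ p q (f : 'rV[R]_n -> R) (A : 'rV[R]_n -> 'M[R]_(p, q)) x :
  differentiable f x -> mx_diff A x -> mx_diff (fun y => f y *: A y) x.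
Proof.
by move=> df dA i j; under eq_fun do rewrite mxE; exact: differentiableM.
Qed.

Lemma mx_pderivZ p q (f : 'rV[R]_n -> R) (A : 'rV[R]_n -> 'M[R]_(p, q)) k x :
  differentiable f x -> mx_diff A x ->
  mx_pderiv k (fun y => f y *: A y) x
    = pderiv k f x *: A x + f x *: mx_pderiv k A x.
Proof.
move=> df dA; apply/matrixP => i j; rewrite !mxE.
by under eq_fun do rewrite mxE; exact: pderivM.
Qed.

(** Cramer's rule: the entries of the inverse are polynomials in the entries
divided by the determinant. *)
Lemma mx_diff_invmx p (A : 'rV[R]_n -> 'M[R]_p) U x :
  open U -> U x -> (forall y, U y -> A y \in unitmx) ->
  mx_diff A x -> mx_diff (fun y => invmx (A y)) x.
Proof.
move=> oU Ux Au dA.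
have ddet q (B : 'rV[R]_n -> 'M[R]_q) : mx_diff B x ->
    differentiable (fun y => \det (B y)) x.
  move=> dB; rewrite /determinant; apply: differentiable_bigsum => s.
  apply: differentiableM; first exact: differentiable_cst.
  by apply: differentiable_bigprod => i.
apply: (@eq_on_mx_diff U _ _ (fun y => (\det (A y))^-1 *: \adj (A y))) => //.
  by move=> y Uy; rewrite /invmx Au.
apply: mx_diffZ.
  apply: differentiableV; first exact: ddet.
  by have := Au _ Ux; rewrite unitmxE unitfE.
move=> i j; under eq_fun do rewrite mxE /cofactor.
apply: differentiableM; first exact: differentiable_cst.
apply: ddet => a b; under eq_fun do rewrite !mxE; exact: dA.
Qed.

(** The hypotheses of [derive_comm], for all entries. *)
Definition mx_C2 U p q (B : 'rV[R]_n -> 'M[R]_(p, q)) : Prop :=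
  forall y, U y -> mx_diff B y /\ forall k, mx_diff (mx_pderiv k B) y.

Lemma eq_on_mx_C2 U p q (A B : 'rV[R]_n -> 'M[R]_(p, q)) :
  open U -> (forall y, U y -> A y = B y) -> mx_C2 U A -> mx_C2 U B.
Proof.
move=> oU AB cA y Uy; have [dA ddA] := cA y Uy; split.
  exact: (eq_on_mx_diff oU Uy AB).
move=> k; apply: (eq_on_mx_diff oU Uy _ (ddA k)) => z Uz.
exact: (eq_on_mx_pderiv k oU Uz).
Qed.

Lemma mx_C2M U p q r (A : 'rV[R]_n -> 'M[R]_(p, q))
    (B : 'rV[R]_n -> 'M[R]_(q, r)) :
  open U -> mx_C2 U A -> mx_C2 U B -> mx_C2 U (fun y => A y *m B y).
Proof.
move=> oU cA cB y Uy; have [dA ddA] := cA y Uy; have [dB ddB] := cB y Uy.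
split; first exact: mx_diffM.
move=> k; have E z : U z -> mx_pderiv k A z *m B z + A z *m mx_pderiv k B z
    = mx_pderiv k (fun y => A y *m B y) z.
  by move=> Uz; rewrite mx_pderivM //; [case: (cA z Uz)|case: (cB z Uz)].
by apply: (eq_on_mx_diff oU Uy E); apply: mx_diffD; apply: mx_diffM.
Qed.

Lemma mx_C2T U p q (A : 'rV[R]_n -> 'M[R]_(p, q)) :
  mx_C2 U A -> mx_C2 U (fun y => (A y)^T).
Proof.
move=> cA y Uy; have [dA ddA] := cA y Uy; split; first exact: mx_diffT.
move=> k; rewrite (_ : mx_pderiv k _ = fun y => (mx_pderiv k A y)^T).
  exact: mx_diffT.
by apply/funext => z; rewrite mx_pderivT.
Qed.

Lemma mx_pderiv_comm U p q (B : 'rV[R]_n -> 'M[R]_(p, q)) k l x :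
  open U -> U x -> mx_C2 U B ->
  mx_pderiv k (mx_pderiv l B) x = mx_pderiv l (mx_pderiv k B) x.
Proof.
move=> oU Ux cB; apply/matrixP => i j.
have E m : (fun y => mx_pderiv m B y i j) = pderiv m (fun y => B y i j).
  by apply/funext => y; rewrite /mx_pderiv mxE.
rewrite [LHS]mxE [RHS]mxE !E.
have [_ ddB] := cB x Ux; apply: derive_comm.
- by apply: (open_near oU Ux) => y Uy; have [] := cB y Uy.
- by have := ddB k i j; rewrite E.
- by have := ddB l i j; rewrite E.
Qed.

End MatrixCalculus.

Section Smooth.
Variables (R : realType) (n : nat).

Lemma mx_diff_of_differentiable p q (B : 'rV[R]_n -> 'M[R]_(p, q)) x :
  differentiable B x -> mx_diff B x.
Proof.
move=> dB i j.
exact: (@differentiable_comp _ _ _ _ B (fun N => N i j) x dB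
  (differentiable_coord _ _ _)).
Qed.

Lemma smooth_on_C2 (D U : set 'rV[R]_n) p q
    (B : 'rV[R]_n -> 'M[R]_(p, q)) :
  open U -> U `<=` D -> smooth_on D B -> mx_C2 U B.
Proof.
move=> oU UD sB y Uy; split.
  by apply: mx_diff_of_differentiable; apply: (sB [::]); exact: UD.
move=> k; apply: (@eq_on_mx_diff _ _ U _ _ (pderiv k B)) => //.
  move=> z Uz; rewrite /pderiv derive_mx //.
  by apply: diff_derivable; apply: (sB [::]); exact: UD.
by apply: mx_diff_of_differentiable; apply: (sB [:: k]); exact: UD.
Qed.
End Smooth.

Global Opaque mx_pderiv.

(** * The Ricci identity *)

(** A linear identity between products of matrices is checked entrywise, with
the products as unknowns. *)
Ltac mx_linear :=
  repeat match goal with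
  | |- context [mulmx ?A ?B] => let p := fresh "p" in move: (mulmx A B) => p
  end;
  repeat match goal with
  | |- context [mx_pderiv ?k ?A ?y] => let p := fresh "p" in move: (mx_pderiv k A y) => p
  end;
  apply/matrixP; let i := fresh "i" in let j := fresh "j" in
  intros i j; rewrite !mxE; ring.

Section Connection.
Variables (R : realType) (n : nat).
Variable G : 'I_n -> 'rV[R]_n -> 'M[R]_n.
Implicit Types (x y : 'rV[R]_n) (U : set 'rV[R]_n) (i j k l : 'I_n).
Implicit Types (B : 'rV[R]_n -> 'M[R]_n) (f : 'rV[R]_n -> R).

(** The row [i] of [G k] consists of the components of the derivative of the
coordinate field d_i in the direction d_k; [covd k B] is then the covariant
derivative of the 2-tensor [B]. *)
Definition covd k B x : 'M[R]_n :=
  mx_pderiv k B x - G k x *m B x - B x *m (G k x)^T.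

Definition curv i j x : 'M[R]_n :=
  mx_pderiv i (G j) x - mx_pderiv j (G i) x
  + (G j x *m G i x - G i x *m G j x).

Lemma curv_anti i j x : curv j i x = - curv i j x.
Proof. by rewrite /curv opprD !opprB. Qed.

(** The terms of first order in [B] and the products of [B] with two different
factors [G i], [G j] on its two sides are symmetric in [i] and [j]. There is no
torsion term because [covd i] does not differentiate the index [j] of [covd j]. *)
Lemma ricci_identity U B x i j :
    open U -> U x -> (forall k, mx_diff (G k) x) -> mx_C2 U B ->
  covd i (covd j B) x - covd j (covd i B) x
    = - (curv i j x *m B x + B x *m (curv i j x)^T).
Proof.
move=> oU Ux dG cB; have [dB ddB] := cB x Ux.
have dcovd k l : mx_pderiv k (covd l B) x = mx_pderiv k (mx_pderiv l B) x
    - (mx_pderiv k (G l) x *m B x + G l x *m mx_pderiv k B x)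
    - (mx_pderiv k B x *m (G l x)^T + B x *m (mx_pderiv k (G l) x)^T).
  have E : covd l B = fun y => mx_pderiv l B y
      + ((-1) *: (G l y *m B y) + (-1) *: (B y *m (G l y)^T)).
    by apply/funext => y; rewrite /covd !scaleN1r addrA.
  have dGB : mx_diff (fun y => G l y *m B y) x by exact: mx_diffM.
  have dBG : mx_diff (fun y => B y *m (G l y)^T) x.
    by apply: mx_diffM => //; exact: mx_diffT.
  have dN A : mx_diff A x -> mx_diff (fun y => (-1 : R) *: (A y : 'M[R]_n)) x.
    by move=> dA; exact: mx_diffZ.
  have pN A : mx_diff A x ->
      mx_pderiv k (fun y => (-1 : R) *: (A y : 'M[R]_n)) x = - mx_pderiv k A x.
    move=> dA; rewrite mx_pderivZ //.
    by rewrite /pderiv derive_cst scale0r add0r scaleN1r.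
  rewrite E mx_pderivD //; last by apply: mx_diffD; exact: dN.
  rewrite mx_pderivD; [|exact: dN|exact: dN].
  rewrite !pN // !mx_pderivM //; last exact: mx_diffT.
  by rewrite mx_pderivT addrA.
rewrite {1 3}/covd !dcovd (mx_pderiv_comm i j oU Ux cB) /covd /curv.
have tD (A C : 'M[R]_n) : (A + C)^T = A^T + C^T by rewrite linearD.
have tN (A : 'M[R]_n) : (- A)^T = - A^T by rewrite linearN.
rewrite !(tD, tN) !trmx_mul.
rewrite !(mulmxDl, mulmxDr, mulmxBl, mulmxBr, mulNmx, mulmxN, mulmxA).
mx_linear.
Qed.

Lemma covdZ f B k x : differentiable f x -> mx_diff B x ->
  covd k (fun y => f y *: B y) x = pderiv k f x *: B x + f x *: covd k B x.
Proof.
move=> df dB; rewrite /covd mx_pderivZ // -!scalemxAl -!scalemxAr !scalerBr.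
by rewrite !addrA.
Qed.

Lemma eq_on_covd U A B k x : open U -> U x ->
  (forall y, U y -> A y = B y) -> covd k A x = covd k B x.
Proof.
by move=> oU Ux AB; rewrite /covd (eq_on_mx_pderiv k oU Ux AB) AB.
Qed.

Lemma covdD A B k x : mx_diff A x -> mx_diff B x ->
  covd k (fun y => A y + B y) x = covd k A x + covd k B x.
Proof.
move=> dA dB; rewrite /covd mx_pderivD // mulmxDl mulmxDr; mx_linear.
Qed.

End Connection.

Section QuaternionicCurvature.
Variables (R : realType) (G : 'I_4 -> 'rV[R]_4 -> 'M[R]_4).
Variables (U : set 'rV[R]_4) (P Q S : 'rV[R]_4 -> 'M[R]_4).
Variables (p q r : 'rV[R]_4 -> 'rV[R]_4) (x : 'rV[R]_4).
Hypotheses (oU : open U) (Ux : U x) (dG : forall k, mx_diff (G k) x).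
Hypotheses (cP : mx_C2 U P) (dQ : mx_diff Q x) (dS : mx_diff S x).
Hypotheses (dq : mx_diff q x) (dr : mx_diff r x).
Hypothesis covdP : forall y k, U y ->
  covd G k P y = r y 0 k *: Q y - q y 0 k *: S y.
Hypothesis covdQ : forall k, covd G k Q x = p x 0 k *: S x - r x 0 k *: P x.
Hypothesis covdS : forall k, covd G k S x = q x 0 k *: P x - p x 0 k *: Q x.

(** Here the covariant derivatives rotate the triple (P, Q, S) with
coefficients (p, q, r). Differentiating the equation for [P] once more and
substituting the other two leaves the curvature of the rotation; the component
along [P] itself is symmetric in [i] and [j] and drops out. *)
Lemma curvature_of_rotating_form i j :
  curv G i j x *m P x + P x *m (curv G i j x)^T
    = (ext_deriv q x + wedge (r x) (p x)) i j *: S x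
      - (ext_deriv r x + wedge (p x) (q x)) i j *: Q x.
Proof.
have := ricci_identity i j oU Ux dG cP.
have second k l : covd G k (covd G l P) x =
   pderiv k (fun y => r y 0 l) x *: Q x + r x 0 l *: covd G k Q x
   - (pderiv k (fun y => q y 0 l) x *: S x + q x 0 l *: covd G k S x).
  have E y : U y -> covd G l P y = r y 0 l *: Q y + (-1) *: (q y 0 l *: S y).
    by move=> Uy; rewrite covdP // scaleN1r.
  have dqS : mx_diff (fun y => q y 0 l *: S y) x by exact: mx_diffZ.
  have d1 : differentiable (cst (-1 : R) : 'rV[R]_4 -> R) x.
    exact: differentiable_cst.
  rewrite (eq_on_covd _ _ oU Ux E) covdD.
  - rewrite covdZ // (covdZ G k d1 dqS) covdZ //.
    by rewrite /pderiv derive_cst scale0r add0r scaleN1r.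
  - exact: mx_diffZ.
  - exact: mx_diffZ.
rewrite !second !covdQ !covdS => H.
rewrite -[LHS]opprK -H.
apply/matrixP => a b; rewrite !mxE !big_ord1 !mxE; ring.
Qed.

End QuaternionicCurvature.

(** * The Levi-Civita connection *)

Section LeviCivita.
Variables (R : realType) (g : 'rV[R]_4 -> 'M[R]_4) (U : set 'rV[R]_4).
Hypotheses (oU : open U) (g_C2 : mx_C2 U g).
Hypotheses (g_sym : forall y, U y -> (g y)^T = g y).
Hypothesis (g_unit : forall y, U y -> g y \in unitmx).

Definition conn (k : 'I_4) (y : 'rV[R]_4) : 'M[R]_4 :=
  \matrix_(i, l) christoffel g l k i y.

Lemma connE k y i l : conn k y i l = christoffel g l k i y.
Proof. by rewrite mxE. Qed.

Opaque conn.

(** Christoffel symbols of the first kind. *)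
Definition lowered (k : 'I_4) (y : 'rV[R]_4) : 'M[R]_4 :=
  \matrix_(i, j) (2^-1 * (mx_pderiv k g y i j + mx_pderiv i g y k j
                          - mx_pderiv j g y k i)).

Lemma conn_lowered k y : U y -> conn k y = lowered k y *m invmx (g y).
Proof.
move=> Uy; apply/matrixP => i l; rewrite mxE [RHS]mxE /christoffel mulr_sumr.
have gi : (invmx (g y))^T = invmx (g y) by rewrite trmx_inv g_sym.
apply: eq_bigr => m _; rewrite [lowered _ _ _ _]mxE !mx_pderivE.
by rewrite -[in LHS]gi [_^T _ _]mxE -mulrA; congr (_ * _); rewrite mulrC.
Qed.

Lemma lowered_diff k y : U y -> mx_diff (lowered k) y.
Proof.
move=> Uy i j; have [_ dd] := g_C2 Uy; under eq_fun do rewrite mxE.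
apply: differentiableM; first exact: differentiable_cst.
apply: differentiableB; last exact: dd.
by apply: differentiableD; exact: dd.
Qed.

Lemma conn_diff k y : U y -> mx_diff (conn k) y.
Proof.
move=> Uy.
apply: (@eq_on_mx_diff _ _ U _ _ (fun z => lowered k z *m invmx (g z))) => //.
  by move=> z Uz; rewrite conn_lowered.
apply: mx_diffM; first exact: lowered_diff.
by apply: (mx_diff_invmx oU Uy g_unit); have [] := g_C2 Uy.
Qed.

Lemma mx_pderiv_g_sym k y i j : U y -> mx_pderiv k g y i j = mx_pderiv k g y j i.
Proof.
move=> Uy; have := eq_on_mx_pderiv k oU Uy g_sym.
by rewrite mx_pderivT => E; rewrite -[in LHS]E mxE.
Qed.

Lemma levi_civita_metric k y : U y -> covd conn k g y = 0.
Proof.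
move=> Uy; rewrite /covd conn_lowered // mulmxKV ?g_unit //.
rewrite trmx_mul trmx_inv g_sym // mulKVmx ?g_unit //.
apply/matrixP => i j; rewrite !entryB [(lowered k y)^T i j]mxE.
rewrite ![lowered _ _ _ _]mxE [RHS]mxE.
have cancel (a b c d : R) : a = b ->
    a - 2^-1 * (a + c - d) - 2^-1 * (b + d - c) = 0 by move=> <-; field.
by apply: cancel; exact: mx_pderiv_g_sym.
Qed.

Lemma christoffel_sym l i j y : U y -> christoffel g l i j y = christoffel g l j i y.
Proof.
move=> Uy; rewrite /christoffel; congr (_ * _); apply: eq_bigr => m _.
congr (_ * _); congr (_ - _); first by rewrite addrC.
by rewrite -!mx_pderivE mx_pderiv_g_sym.
Qed.

Lemma conn_sym k i l y : U y -> conn k y i l = conn i y k l.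
Proof. by move=> Uy; rewrite !connE christoffel_sym. Qed.

Lemma curv_riemann i j k l y : curv conn i j y k l = riemann g l k i j y.
Proof.
rewrite /curv /riemann entryD !entryB.
have E m p a b : mx_pderiv m (conn p) y a b = pderiv m (christoffel g b p a) y.
  rewrite mx_pderivE; congr (pderiv _ _ _); apply/funext => z; exact: connE.
congr (_ - _ + _); [exact: E|exact: E|].
rewrite [(conn j y *m _) k l]mxE [(conn i y *m _) k l]mxE -sumrB.
apply: eq_bigr => m _; rewrite !connE.
by congr (_ - _); exact: mulrC.
Qed.

(** Symmetry of the Christoffel symbols makes the derivative terms and the
quadratic terms cancel separately. *)
Lemma first_bianchi i j k l y : U y ->
  curv conn i j y k l + curv conn j k y i l + curv conn k i y j l = 0.
Proof.
move=> Uy.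
pose D m p a b := mx_pderiv m (conn p) y a b.
pose P p m a b := (conn p y *m conn m y) a b.
have curvE a b c d : curv conn a b y c d
    = D a b c d - D b a c d + (P b a c d - P a b c d).
  by rewrite /curv entryD !entryB.
have Dsym m p a b : D m p a b = D m a p b.
  rewrite /D [LHS]mx_pderivE [RHS]mx_pderivE; apply: near_eq_derive.
  by apply: (open_near oU Uy) => z Uz; exact: conn_sym.
have Psym p m a b : P p m a b = P a m p b.
  rewrite /P [LHS]mxE [RHS]mxE; apply: eq_bigr => c _.
  by congr (_ * _); exact: conn_sym.
have E := congr2 +%R (congr2 +%R (curvE i j k l) (curvE j k i l)) (curvE k i j l).
apply: (etrans E); clearbody D P.
rewrite (Dsym i j) (Dsym j k) (Dsym k i) (Psym j i) (Psym k j) (Psym i k); ring.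
Qed.

Lemma ricci_curv x : ricci g x = \matrix_(j, k) \sum_i curv conn i j x k i.
Proof.
by apply/matrixP => j k; rewrite !mxE; apply: eq_bigr => i _; rewrite curv_riemann.
Qed.

Lemma nabla_covd B (k : 'I_4) y : nabla g (delta_mx 0 k) B y = covd conn k B y.
Proof.
apply/matrixP => i j; rewrite mxE (bigD1 k) //= [X in _ + X]big1 ?addr0 => [|m mk]; last first.
  by rewrite mxE eqxx (negbTE mk) mul0r.
rewrite mxE !eqxx mul1r /covd.
rewrite !entryB; congr (_ - _ - _); first by rewrite mx_pderivE.
  by rewrite mxE; apply: eq_bigr => l _; rewrite connE.
by rewrite mxE; apply: eq_bigr => l _; rewrite mxE connE mulrC.
Qed.

Lemma curv_metric_skew i j y : U y ->
  curv conn i j y *m g y + g y *m (curv conn i j y)^T = 0.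
Proof.
move=> Uy; have zero k l : covd conn k (covd conn l g) y = 0.
  rewrite (eq_on_covd _ _ oU Uy (fun z Uz => levi_civita_metric l Uz)).
  rewrite /covd mulmx0 mul0mx !subr0; apply/matrixP => a b.
  rewrite mx_pderivE [RHS]mxE; under eq_fun do rewrite mxE.
  exact: derive_cst.
have dG k : mx_diff (conn k) y by exact: conn_diff.
have := ricci_identity i j oU Uy dG g_C2.
by rewrite !zero subrr => /esym/eqP; rewrite oppr_eq0 => /eqP.
Qed.

End LeviCivita.

(** * The Ricci tensor from the commutators with the complex structures *)

Section Quaternions.
Variables (R : pzRingType) (n : nat).

(** The sign in [J1 *m J2 = - J3] is the one of endomorphisms with J_1 J_2 = J_3
that act on rows. *)
Definition quaternion_triple (J1 J2 J3 : 'M[R]_n) : Prop :=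
  [/\ J1 *m J1 = - 1%:M, J2 *m J2 = - 1%:M, J3 *m J3 = - 1%:M
    & J1 *m J2 = - J3].

Variables J1 J2 J3 : 'M[R]_n.
Hypothesis quatJ : quaternion_triple J1 J2 J3.

(** J1 J2 J1 J2 = J3 J3 = - 1, multiplied by [J1] on the left and by [J2] on the
right. *)
Lemma quaternion_rev : J2 *m J1 = J3.
Proof.
have [s1 s2 s3 s12] := quatJ.
have s3' : J1 *m J2 *m (J1 *m J2) = - 1%:M by rewrite s12 mulNmx mulmxN opprK.
have : J1 *m (J1 *m J2 *m (J1 *m J2)) *m J2 = J3.
  by rewrite s3' mulmxN mulmx1 mulNmx s12 opprK.
by rewrite !mulmxA s1 -!mulmxA s2 !mulmxN mulmx1 !mulNmx mul1mx opprK.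
Qed.

Lemma quaternion_rot : quaternion_triple J2 J3 J1.
Proof.
have [s1 s2 s3 s12] := quatJ; split=> //.
rewrite -quaternion_rev mulmxA s2 mulNmx mul1mx //.
Qed.

End Quaternions.

Section PairSymmetry.
Variables (R : realFieldType) (I : Type) (f : I -> I -> I -> I -> R).
Hypothesis f_anti12 : forall i j k l, f j i k l = - f i j k l.
Hypothesis f_anti34 : forall i j k l, f i j l k = - f i j k l.
Hypothesis f_bianchi : forall i j k l, f i j k l + f j k i l + f k i j l = 0.

(** The octahedron argument: the four Bianchi identities that start at each of
the four indices. *)
Lemma riemann_pair_symmetry i j k l : f i j k l = f k l i j.
Proof.
have := f_bianchi i j k l; have := f_bianchi j k l i.
have := f_bianchi k l i j; have := f_bianchi l i j k.
have := f_anti34 i j k l; have := f_anti34 j k i l; have := f_anti34 k i j l.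
have := f_anti34 k l i j; have := f_anti34 l j k i; have := f_anti34 l i j k.
have := f_anti12 j l k i; have := f_anti12 i l j k; have := f_anti12 i k l j.
have := f_anti34 j l k i; have := f_anti34 i l j k; have := f_anti34 i k l j.
have := f_anti34 k i l j.
lra.
Qed.

End PairSymmetry.

Section RicciOfQuaternionicCurvature.
Variables (R : realFieldType) (g : 'M[R]_4) (Rm : 'I_4 -> 'I_4 -> 'M[R]_4).
Hypotheses (g_sym : g^T = g) (g_unit : g \in unitmx).
Hypothesis Rm_anti : forall i j, Rm j i = - Rm i j.
Hypothesis Rm_bianchi : forall i j k l,
  Rm i j k l + Rm j k i l + Rm k i j l = 0.
Hypothesis Rm_skew : forall i j, Rm i j *m g + g *m (Rm i j)^T = 0.

Let L i j := Rm i j *m g.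
Let ric : 'M[R]_4 := \matrix_(j, k) \sum_i Rm i j k i.

Let L_anti12 i j k l : L j i k l = - L i j k l.
Proof. by rewrite /L Rm_anti mulNmx mxE. Qed.

Let L_anti34 i j k l : L i j l k = - L i j k l.
Proof.
have LT : (L i j)^T = - L i j.
  apply/eqP; rewrite -addr_eq0 addrC /L trmx_mul g_sym.
  by apply/eqP; exact: Rm_skew.
by have := congr1 (fun A : 'M[R]_4 => A k l) LT; rewrite [LHS]mxE [RHS]mxE.
Qed.

Let L_bianchi i j k l : L i j k l + L j k i l + L k i j l = 0.
Proof.
rewrite /L [(Rm i j *m g) k l]mxE [(Rm j k *m g) i l]mxE [(Rm k i *m g) j l]mxE.
rewrite -!big_split /= big1 // => m _.
by rewrite -!mulrDl Rm_bianchi mul0r.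
Qed.

Let L_pair i j k l : L i j k l = L k l i j.
Proof. exact: (riemann_pair_symmetry L_anti12 L_anti34 L_bianchi). Qed.

Let Rm_mul i j (A : 'M[R]_4) k l :
  (Rm i j *m A) k l = \sum_m L i j k m * (invmx g *m A) m l.
Proof. by rewrite -[Rm i j](mulmxK g_unit) -(mulmxA (_ *m g)) mxE. Qed.

Lemma ricci_contraction_sym : ric^T = ric.
Proof.
have gi i j : invmx g i j = invmx g j i by rewrite -[in LHS]g_sym -trmx_inv mxE.
apply/matrixP => j k; rewrite !mxE.
have E j' k' : \sum_i Rm i j' k' i = \sum_i \sum_l L i j' k' l * invmx g l i.
  by apply: eq_bigr => i _; rewrite -[Rm i j']mulmx1 Rm_mul mulmx1.
rewrite !E exchange_big /=; apply: eq_bigr => i _; apply: eq_bigr => l _.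
by rewrite (gi i l) L_pair L_anti12 L_anti34 opprK.
Qed.

Variables J1 J2 J3 F1 F2 F3 : 'M[R]_4.
Hypothesis quatJ : quaternion_triple J1 J2 J3.
Hypothesis J1_skew : (J1 *m g)^T = - (J1 *m g).
Hypotheses (F2_anti : F2^T = - F2) (F3_anti : F3^T = - F3).
Hypothesis Rm_J1 : forall i j,
  Rm i j *m J1 - J1 *m Rm i j = F2 i j *: J3 - F3 i j *: J2.
Hypothesis Rm_J2 : forall i j,
  Rm i j *m J2 - J2 *m Rm i j = F3 i j *: J1 - F1 i j *: J3.

(** The commutator with [J2], multiplied by [J3]: the left-hand side has trace
- 2 \tr (Rm J1) as J2 J3 = - J1 and J3 J2 = J1, the right-hand side 4 F1. *)
Let trace_Rm_J1 i j : \tr (Rm i j *m J1) = - (2 * F1 i j).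
Proof.
have [_ _ s3 _] := quatJ.
have q1 := quaternion_rot quatJ; have q2 := quaternion_rot q1.
have [_ _ _ s23] := q1; have [_ _ _ s31] := q2.
have s32 := quaternion_rev q1; have s13 := quaternion_rev q2.
have tr2 : \tr J2 = 0.
  have : \tr (J1 *m J3) = - \tr (J1 *m J3).
    by rewrite {1}mxtrace_mulC s31 s13 raddfN.
  rewrite s13 => e; lra.
have := congr1 (fun A => \tr (A *m J3)) (Rm_J2 i j).
rewrite !mulmxBl -!scalemxAl -mulmxA s23 s13 s3 !raddfB /= !mxtraceZ tr2 mulr0.
rewrite mulmxN !raddfN /= mxtrace1 -[X in _ - X]mxtrace_mulC mulmxA s32.
rewrite [\tr (J1 *m _)]mxtrace_mulC => e; lra.
Qed.

(** With [K] the bivector dual to the form of [J1], the left-hand side is the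
contraction \sum_(i, l) L i j v l * K l i. The Bianchi identity and the pair
symmetry make it -1/2 times \sum_(i, l) L j v i l * K l i, the trace of
[Rm j v *m J1]. *)
Let contraction_Rm_J1 j v : \sum_i (Rm i j *m J1) v i = F1 j v.
Proof.
pose K := invmx g *m J1.
have K_anti l i : K i l = - K l i.
  have KT : K^T = - K.
    rewrite /K trmx_mul trmx_inv g_sym; apply: (can_inj (mulKmx g_unit)).
    rewrite mulmxN mulKVmx // mulmxA -[X in X *m J1^T]g_sym -trmx_mul J1_skew.
    by rewrite mulNmx mulmxK.
  by rewrite -[in LHS](trmxK K) mxE KT mxE.
have S : \sum_i (Rm i j *m J1) v i = \sum_i \sum_l L i j v l * K l i.
  by apply: eq_bigr => i _; rewrite Rm_mul.
have T : \tr (Rm j v *m J1) = \sum_i \sum_l L j v i l * K l i.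
  by apply: eq_bigr => i _; rewrite Rm_mul.
have S' : \sum_i \sum_l L v i j l * K l i = \sum_i \sum_l L i j v l * K l i.
  rewrite exchange_big /=; apply: eq_bigr => i _; apply: eq_bigr => l _.
  by rewrite L_pair L_anti12 K_anti mulrNN.
have Z : \sum_i \sum_l L i j v l * K l i + \sum_i \sum_l L j v i l * K l i
    + \sum_i \sum_l L v i j l * K l i = 0.
  rewrite -!big_split /= big1 // => i _; rewrite -!big_split /= big1 // => l _.
  by rewrite -!mulrDl L_bianchi mul0r.
by move: Z; rewrite S' -T -S trace_Rm_J1 => e; lra.
Qed.

(** Moving [J1] through the curvature in Ric J1^T produces the contraction
above and the two terms of the commutator; multiplying by [J1^T] again, whose
square is -1, isolates Ric. *)
Lemma ricci_of_quaternionic_curvature :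
  ric = - (F1 *m J1^T + F2 *m J2^T + F3 *m J3^T).
Proof.
have [s1 _ _ s12] := quatJ.
have s13 := quaternion_rev (quaternion_rot (quaternion_rot quatJ)).
have ricJ : ric *m J1^T = F1 + F2 *m J3^T - F3 *m J2^T.
  apply/matrixP => j v; rewrite mxE.
  have -> : \sum_k ric j k * J1^T k v = \sum_i (J1 *m Rm i j) v i.
    under eq_bigr => k _ do rewrite !mxE mulr_suml.
    rewrite exchange_big /=; apply: eq_bigr => i _; rewrite mxE.
    by apply: eq_bigr => k _; rewrite mulrC.
  have -> : \sum_i (J1 *m Rm i j) v i = \sum_i (Rm i j *m J1) v i
      - \sum_i (F2 i j * J3 v i - F3 i j * J2 v i).
    rewrite -sumrB; apply: eq_bigr => i _.
    have -> : J1 *m Rm i j = Rm i j *m J1 - (F2 i j *: J3 - F3 i j *: J2).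
      by rewrite -Rm_J1 opprB addrC subrK.
    by rewrite !mxE.
  have FJ (F J : 'M[R]_4) : F^T = - F ->
      \sum_i F i j * J v i = - (F *m J^T) j v.
    move=> F_anti; rewrite mxE -sumrN; apply: eq_bigr => i _.
    have := congr1 (fun A : 'M[R]_4 => A j i) F_anti.
    by rewrite [LHS]mxE [RHS]mxE [J^T i v]mxE -mulNr => ->.
  rewrite contraction_Rm_J1 sumrB !FJ //.
  have entry (A B C : 'M[R]_4) : (A + B - C) j v = A j v + B j v - C j v.
    by rewrite !mxE.
  by rewrite entry; ring.
have J1T : J1^T *m J1^T = - 1%:M by rewrite -trmx_mul s1 linearN /= trmx1.
rewrite -[LHS]opprK -[ric]mulmx1 -mulmxN -J1T mulmxA ricJ.
rewrite mulmxBl mulmxDl -!mulmxA -!trmx_mul s13 s12.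
by rewrite linearN /= mulmxN opprK.
Qed.

End RicciOfQuaternionicCurvature.

(** * Self-duality in the standard coframe *)

Section FourByFour.
Variable R : realType.
Implicit Types (A B C : 'M[R]_4) (al be u v : 'rV[R]_4).

Lemma sum_ord4 (V : nmodType) (F : 'I_4 -> V) :
  \sum_i F i = F 0 + F 1 + F 2 + F 3.
Proof.
rewrite !big_ord_recl big_ord0 addr0 !addrA.
by congr (F _ + F _ + F _ + F _); apply: val_inj.
Qed.

Lemma ord4_ind (P : 'I_4 -> Prop) : P 0 -> P 1 -> P 2 -> P 3 -> forall i, P i.
Proof.
move=> P0 P1 P2 P3 [[|[|[|[|//]]]] lti].
- by rewrite (_ : Ordinal lti = 0) //; apply: val_inj.
- by rewrite (_ : Ordinal lti = 1) //; apply: val_inj.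
- by rewrite (_ : Ordinal lti = 2) //; apply: val_inj.
- by rewrite (_ : Ordinal lti = 3) //; apply: val_inj.
Qed.

Lemma wedge_anti al be : (wedge al be)^T = - wedge al be.
Proof. by rewrite /wedge linearB /= !trmx_mul !trmxK opprB. Qed.

Lemma wedge_swap al be : wedge be al = - wedge al be.
Proof. by rewrite /wedge opprB. Qed.

Lemma wedge_mulmx al be A : wedge (al *m A) (be *m A) = A^T *m wedge al be *m A.
Proof. by rewrite /wedge !trmx_mul mulmxBr mulmxBl !mulmxA. Qed.


(** Matrices given by their sixteen entries: identities between explicit
matrices become sixteen polynomial identities. *)
Definition mx4 (a00 a01 a02 a03 a10 a11 a12 a13
    a20 a21 a22 a23 a30 a31 a32 a33 : R) : 'M[R]_4 :=
  \matrix_(i, j) nth 0 (nth [::] [:: [:: a00; a01; a02; a03];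
    [:: a10; a11; a12; a13]; [:: a20; a21; a22; a23];
    [:: a30; a31; a32; a33]] i) j.

Lemma mx4_eta A : A = mx4 (A 0 0) (A 0 1) (A 0 2) (A 0 3)
  (A 1 0) (A 1 1) (A 1 2) (A 1 3) (A 2 0) (A 2 1) (A 2 2) (A 2 3)
  (A 3 0) (A 3 1) (A 3 2) (A 3 3).
Proof. by apply/matrixP; apply: ord4_ind; apply: ord4_ind; rewrite mxE. Qed.

Section Mx4Operations.
Variables a00 a01 a02 a03 a10 a11 a12 a13 a20 a21 a22 a23 a30 a31 a32 a33 : R.
Variables b00 b01 b02 b03 b10 b11 b12 b13 b20 b21 b22 b23 b30 b31 b32 b33 : R.
Let A := mx4 a00 a01 a02 a03 a10 a11 a12 a13 a20 a21 a22 a23 a30 a31 a32 a33.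
Let B := mx4 b00 b01 b02 b03 b10 b11 b12 b13 b20 b21 b22 b23 b30 b31 b32 b33.

Lemma mx4_add : A + B = mx4
    (a00 + b00) (a01 + b01) (a02 + b02) (a03 + b03)
    (a10 + b10) (a11 + b11) (a12 + b12) (a13 + b13)
    (a20 + b20) (a21 + b21) (a22 + b22) (a23 + b23)
    (a30 + b30) (a31 + b31) (a32 + b32) (a33 + b33).
Proof. by apply/matrixP; apply: ord4_ind; apply: ord4_ind; rewrite !mxE. Qed.

Lemma mx4_opp : - A = mx4
    (- a00) (- a01) (- a02) (- a03)
    (- a10) (- a11) (- a12) (- a13)
    (- a20) (- a21) (- a22) (- a23)
    (- a30) (- a31) (- a32) (- a33).
Proof. by apply/matrixP; apply: ord4_ind; apply: ord4_ind; rewrite !mxE. Qed.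

Lemma mx4_scale c : c *: A = mx4
    (c * a00) (c * a01) (c * a02) (c * a03)
    (c * a10) (c * a11) (c * a12) (c * a13)
    (c * a20) (c * a21) (c * a22) (c * a23)
    (c * a30) (c * a31) (c * a32) (c * a33).
Proof. by apply/matrixP; apply: ord4_ind; apply: ord4_ind; rewrite !mxE. Qed.

Lemma mx4_tr : A^T = mx4
    (a00) (a10) (a20) (a30)
    (a01) (a11) (a21) (a31)
    (a02) (a12) (a22) (a32)
    (a03) (a13) (a23) (a33).
Proof. by apply/matrixP; apply: ord4_ind; apply: ord4_ind; rewrite !mxE. Qed.

Lemma mx4_mul : A *m B = mx4
    (a00 * b00 + a01 * b10 + a02 * b20 + a03 * b30)
    (a00 * b01 + a01 * b11 + a02 * b21 + a03 * b31)
    (a00 * b02 + a01 * b12 + a02 * b22 + a03 * b32)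
    (a00 * b03 + a01 * b13 + a02 * b23 + a03 * b33)
    (a10 * b00 + a11 * b10 + a12 * b20 + a13 * b30)
    (a10 * b01 + a11 * b11 + a12 * b21 + a13 * b31)
    (a10 * b02 + a11 * b12 + a12 * b22 + a13 * b32)
    (a10 * b03 + a11 * b13 + a12 * b23 + a13 * b33)
    (a20 * b00 + a21 * b10 + a22 * b20 + a23 * b30)
    (a20 * b01 + a21 * b11 + a22 * b21 + a23 * b31)
    (a20 * b02 + a21 * b12 + a22 * b22 + a23 * b32)
    (a20 * b03 + a21 * b13 + a22 * b23 + a23 * b33)
    (a30 * b00 + a31 * b10 + a32 * b20 + a33 * b30)
    (a30 * b01 + a31 * b11 + a32 * b21 + a33 * b31)
    (a30 * b02 + a31 * b12 + a32 * b22 + a33 * b32)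
    (a30 * b03 + a31 * b13 + a32 * b23 + a33 * b33).
Proof.
by apply/matrixP; apply: ord4_ind; apply: ord4_ind; rewrite !mxE sum_ord4 !mxE.
Qed.

Lemma mx4_trace : \tr A = a00 + a11 + a22 + a33.
Proof. by rewrite /mxtrace sum_ord4 !mxE. Qed.

Lemma mx4_det : \det A =
    a00 * a11 * a22 * a33 - a00 * a11 * a23 * a32 - a00 * a12 * a21 *
    a33 + a00 * a12 * a23 * a31 + a00 * a13 * a21 * a32 - a00 * a13 *
    a22 * a31 - a01 * a10 * a22 * a33 + a01 * a10 * a23 * a32 + a01 *
    a12 * a20 * a33 - a01 * a12 * a23 * a30 - a01 * a13 * a20 * a32 +
    a01 * a13 * a22 * a30 + a02 * a10 * a21 * a33 - a02 * a10 * a23 *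
    a31 - a02 * a11 * a20 * a33 + a02 * a11 * a23 * a30 + a02 * a13 *
    a20 * a31 - a02 * a13 * a21 * a30 - a03 * a10 * a21 * a32 + a03 *
    a10 * a22 * a31 + a03 * a11 * a20 * a32 - a03 * a11 * a22 * a30 -
    a03 * a12 * a20 * a31 + a03 * a12 * a21 * a30.
Proof.
rewrite (expand_det_row _ ord0) !big_ord_recl big_ord0 /cofactor.
rewrite !(expand_det_row _ (ord0 : 'I_3)) !big_ord_recl !big_ord0 /cofactor.
rewrite !(expand_det_row _ (ord0 : 'I_2)) !big_ord_recl !big_ord0 /cofactor.
rewrite !det_mx11 !mxE /=; ring.
Qed.

End Mx4Operations.


(** The forms e^12 + e^34, e^13 + e^42 and e^14 + e^23. *)
Definition std1 := mx4 0 1 0 0  (-1) 0 0 0  0 0 0 1  0 0 (-1) 0.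
Definition std2 := mx4 0 0 1 0  0 0 0 (-1)  (-1) 0 0 0  0 1 0 0.
Definition std3 := mx4 0 0 0 1  0 0 1 0  0 (-1) 0 0  (-1) 0 0 0.

Ltac mx4_ring := rewrite ?(mx4_tr, mx4_mul, mx4_scale, mx4_opp, mx4_add);
  f_equal; ring.

Lemma mx4_1 : 1%:M = mx4 1 0 0 0  0 1 0 0  0 0 1 0  0 0 0 1.
Proof. by apply/matrixP; apply: ord4_ind; apply: ord4_ind; rewrite !mxE. Qed.

Lemma std_quaternion : quaternion_triple std1 std2 std3.
Proof. by split; rewrite ?mx4_1 /std1 /std2 /std3; mx4_ring. Qed.

(** The average of [A] over the group generated by the quaternion triple.
Anti-self-dual forms are invariant under J_1, J_2, J_3; W_i is invariant under
J_i, and the other two change its sign. On 2-forms the average is therefore the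
anti-self-dual projection. *)
Definition avg (J1 J2 J3 A : 'M[R]_4) : 'M[R]_4 :=
  4^-1 *: (A + J1 *m A *m J1^T + J2 *m A *m J2^T + J3 *m A *m J3^T).

Lemma std_self_dual_part A : A^T = - A ->
  A - avg std1 std2 std3 A = (4^-1 * \tr (A *m std1^T)) *: std1
    + (4^-1 * \tr (A *m std2^T)) *: std2 + (4^-1 * \tr (A *m std3^T)) *: std3.
Proof.
move=> A_anti.
have E i j : A j i = - A i j.
  by have := congr1 (fun B : 'M[R]_4 => B i j) A_anti; rewrite [LHS]mxE [RHS]mxE.
have D i : A i i = 0 by have := E i i; lra.
rewrite /avg /std1 /std2 /std3.
rewrite [A]mx4_eta !D (E 0 1) (E 0 2) (E 0 3) (E 1 2) (E 1 3) (E 2 3).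
rewrite !mx4_tr !mx4_mul !mx4_trace.
rewrite !(mx4_scale, mx4_opp, mx4_add).
by f_equal; field.
Qed.

(** The Hodge star of the standard coframe on 2-forms: A = A^+ + A^- has
star A = A^+ - A^-, and A^- is the average. *)
Definition star A : 'M[R]_4 := A - 2 *: avg std1 std2 std3 A.

Lemma star_mx4 (a b c d e f : R) :
  star (mx4 0 a b c  (- a) 0 d e  (- b) (- d) 0 f  (- c) (- e) (- f) 0)
  = mx4 0 f (- e) d  (- f) 0 c (- b)  e (- c) 0 a  (- d) b (- a) 0.
Proof.
rewrite /star /avg /std1 /std2 /std3 !mx4_tr !mx4_mul.
rewrite !(mx4_scale, mx4_opp, mx4_add).
by f_equal; field.
Qed.

Lemma wedge_mx4 u v : wedge u v =
  let m i j := u 0 i * v 0 j - v 0 i * u 0 j in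
  mx4 0 (m 0 1) (m 0 2) (m 0 3)  (- m 0 1) 0 (m 1 2) (m 1 3)
      (- m 0 2) (- m 1 2) 0 (m 2 3)  (- m 0 3) (- m 1 3) (- m 2 3) 0.
Proof.
have wE i j : wedge u v i j = u 0 i * v 0 j - v 0 i * u 0 j.
  by rewrite !mxE !big_ord1 !mxE.
rewrite /= [LHS]mx4_eta !wE; f_equal; ring.
Qed.

(** With columns read as 1-forms in the standard coframe,
det (v1, v2, v3, v4) = star (v3 /\ v4) (v1, v2). This replaces the volume form in
the definition of the Hodge star by an average, which leaves no determinant. *)
Lemma det_columns_star C (i j k l : 'I_4) :
  \det (\matrix_(p < 4, q < 4) C p (tnth [tuple i; j; k; l] q))
  = (C^T *m star (wedge (row k C^T) (row l C^T)) *m C) i j.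
Proof.
have -> : \matrix_(p < 4, q < 4) C p (tnth [tuple i; j; k; l] q)
  = mx4 (C 0 i) (C 0 j) (C 0 k) (C 0 l) (C 1 i) (C 1 j) (C 1 k) (C 1 l)
        (C 2 i) (C 2 j) (C 2 k) (C 2 l) (C 3 i) (C 3 j) (C 3 k) (C 3 l).
  by apply/matrixP; apply: ord4_ind; apply: ord4_ind; rewrite !mxE.
rewrite mx4_det wedge_mx4 /= star_mx4.
have rE m p : row m C^T 0 p = C p m by rewrite !mxE.
rewrite mxE sum_ord4 ![(C^T *m _) _ _]mxE !sum_ord4.
rewrite ![C^T _ _]mxE ![mx4 _ _ _ _ _ _ _ _ _ _ _ _ _ _ _ _ _ _]mxE /= !rE.
ring.
Qed.
End FourByFour.

(** * Self-duality in an adapted coframe *)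

Section Averaging.
Variables (R : realType) (J1 J2 J3 : 'M[R]_4).
Implicit Types A B P Q : 'M[R]_4.

Lemma avg_tr A : (avg J1 J2 J3 A)^T = avg J1 J2 J3 A^T.
Proof.
have tD B D : (B + D : 'M[R]_4)^T = B^T + D^T by rewrite linearD.
by rewrite /avg linearZ /= !tD !trmx_mul !trmxK !mulmxA.
Qed.

Lemma avgN A : avg J1 J2 J3 (- A) = - avg J1 J2 J3 A.
Proof. by rewrite /avg !(mulmxN, mulNmx) -!opprD scalerN. Qed.

Lemma avg_conj P Q A : Q *m P = 1%:M ->
  avg (P *m J1 *m Q) (P *m J2 *m Q) (P *m J3 *m Q) (P *m A *m P^T)
    = P *m avg J1 J2 J3 A *m P^T.
Proof.
move=> QP.
have QPT : P^T *m Q^T = 1%:M by rewrite -trmx_mul QP trmx1.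
have E J : P *m J *m Q *m (P *m A *m P^T) *m (P *m J *m Q)^T
    = P *m (J *m A *m J^T) *m P^T.
  rewrite !trmx_mul !mulmxA -[P *m J *m Q *m P]mulmxA QP mulmx1.
  by rewrite -[_ *m P^T *m Q^T]mulmxA QPT mulmx1.
by rewrite /avg !E -scalemxAr -scalemxAl !mulmxDr !mulmxDl.
Qed.

End Averaging.

Section Star.
Variable R : realType.
Implicit Types (A B : 'M[R]_4).

Lemma sum_entries_trace A B : \sum_i \sum_j A i j * B i j = \tr (A *m B^T).
Proof.
by apply: eq_bigr => i _; rewrite mxE; apply: eq_bigr => j _; rewrite mxE.
Qed.

Lemma std_anti : [/\ (std1 R)^T = - std1 R, (std2 R)^T = - std2 R
  & (std3 R)^T = - std3 R].
Proof. by split; rewrite mx4_tr mx4_opp; f_equal; ring. Qed.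

Lemma star_tr A : (star A)^T = star A^T.
Proof. by rewrite /star linearB /= linearZ /= avg_tr. Qed.

Lemma starN A : star (- A) = - star A.
Proof. by rewrite /star avgN scalerN -opprD. Qed.

Lemma star_adjoint A B : \tr (star A *m B^T) = \tr (A *m (star B)^T).
Proof.
have [a1 a2 a3] := std_anti.
have E (J : 'M[R]_4) : J^T = - J ->
    \tr (J *m A *m J^T *m B^T) = \tr (A *m (J *m B^T *m J^T)).
  move=> Ja; rewrite -!mulmxA mxtrace_mulC -!mulmxA Ja.
  by rewrite !(mulNmx, mulmxN).
have tD (X Y : 'M[R]_4) : \tr (X + Y) = \tr X + \tr Y by rewrite linearD.
have tB (X Y : 'M[R]_4) : \tr (X - Y) = \tr X - \tr Y by rewrite linearB.
rewrite star_tr /star mulmxBl mulmxBr !tB -!scalemxAl -!scalemxAr !mxtraceZ.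
by rewrite !mulmxDl !mulmxDr !tD !E.
Qed.

Lemma trace_wedge A (u v : 'rV[R]_4) : A^T = - A ->
  \tr (A *m (wedge u v)^T) = 2 * (u *m A *m v^T) 0 0.
Proof.
move=> A_anti; rewrite wedge_anti /wedge opprB mulmxBr linearB /=.
have E (x y : 'rV[R]_4) : \tr (A *m (x^T *m y)) = (y *m A *m x^T) 0 0.
  by rewrite mulmxA mxtrace_mulC mulmxA /mxtrace big_ord1.
rewrite !E; have -> : (v *m A *m u^T) 0 0 = - (u *m A *m v^T) 0 0.
  have -> : (v *m A *m u^T) 0 0 = (v *m A *m u^T)^T 0 0 by rewrite [RHS]mxE.
  by rewrite !trmx_mul trmxK A_anti mulNmx mulmxN mulmxA mxE.
by ring.
Qed.

End Star.

Section AdaptedCoframe.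
Variables (R : realType) (W : 'I_3 -> 'M[R]_4).
Implicit Types (A B C : 'M[R]_4).

Lemma coframe_std C : su2_coframe W C ->
  [/\ W k1 = C^T *m std1 R *m C, W k2 = C^T *m std2 R *m C
    & W k3 = C^T *m std3 R *m C].
Proof.
have e p i : (delta_mx 0 p : 'rV[R]_4) 0 i = (i == p)%:R by rewrite mxE.
move=> [_ -> -> ->]; rewrite !rowE !wedge_mulmx -!mulmxDl -!mulmxDr.
by split; congr (_ *m _ *m _); rewrite !wedge_mx4 /= !e /= mx4_add;
  rewrite /std1 /std2 /std3; f_equal; ring.
Qed.

(** The metric as a function of the three forms: the product of the standard
forms std1, - std2 (the inverse of std2) and std3 is - 1. *)
Lemma coframe_gram C : su2_coframe W C ->
  C^T *m C = - (W k1 *m invmx (W k2) *m W k3).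
Proof.
move=> hC; have [w1 w2 w3] := coframe_std hC; have [Cu _ _ _] := hC.
have [_ s2 s3 s12] := std_quaternion R.
have CTu : C^T \in unitmx by rewrite unitmx_tr.
have -> : invmx (W k2) = - (invmx C *m std2 R *m invmx C^T).
  have W2K : W k2 *m - (invmx C *m std2 R *m invmx C^T) = 1%:M.
    rewrite w2 mulmxN !mulmxA mulmxK // -[C^T *m _ *m _]mulmxA s2.
    by rewrite mulmxN mulmx1 mulNmx mulmxV // opprK.
  have [W2u _] := mulmx1_unit W2K.
  by rewrite -[LHS]mulmx1 -W2K mulKmx.
rewrite w1 w3 mulmxN mulNmx opprK !mulmxA mulmxK // mulmxKV //.
rewrite -!mulmxA (mulmxA (std1 R)) s12 mulNmx (mulmxA (std3 R)) s3.
by rewrite mulNmx opprK mul1mx.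
Qed.

Hypothesis W_adapted : exists C, su2_coframe W C.

Lemma some_coframeP : su2_coframe W (some_coframe W).
Proof. exact: (@xgetPex _ 0 [set E | su2_coframe W E]). Qed.

Let C := some_coframe W.
Let D := invmx C.

Let Cu : C \in unitmx. Proof. by have [] := some_coframeP. Qed.

Lemma metric_some_coframe : metric W = C^T *m C.
Proof.
apply/matrixP => i j; rewrite /metric summxE mxE; apply: eq_bigr => p _.
by rewrite !mxE big_ord1 !mxE.
Qed.

(** The Gram matrix is determined by [W], so the metric can be computed in the
smooth coframe at hand and is smooth. *)
Lemma metric_coframe E : su2_coframe W E -> metric W = E^T *m E.
Proof.
move=> hE; rewrite metric_some_coframe (coframe_gram hE).
by rewrite (coframe_gram some_coframeP).
Qed.

Lemma adapted_metric_sym : (metric W)^T = metric W.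
Proof. by rewrite metric_some_coframe trmx_mul trmxK. Qed.

Lemma adapted_metric_unit : metric W \in unitmx.
Proof. by rewrite metric_some_coframe unitmx_mul unitmx_tr Cu. Qed.

Let inv_metric : invmx (metric W) = D *m D^T.
Proof.
have K : metric W *m (D *m D^T) = 1%:M.
  by rewrite metric_some_coframe !mulmxA mulmxK // -trmx_mul mulVmx // trmx1.
by rewrite -[LHS]mulmx1 -K mulKmx // adapted_metric_unit.
Qed.

Let JE : [/\ Jmx W k1 = C^T *m std1 R *m D^T, Jmx W k2 = C^T *m std2 R *m D^T
  & Jmx W k3 = C^T *m std3 R *m D^T].
Proof.
by have [w1 w2 w3] := coframe_std some_coframeP; rewrite /Jmx w1 w2 w3;
  split; rewrite inv_metric !mulmxA mulmxK.
Qed.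

Let DC : D^T *m C^T = 1%:M.
Proof. by rewrite -trmx_mul mulmxV // trmx1. Qed.

Let avgC A : avg (C^T *m std1 R *m D^T) (C^T *m std2 R *m D^T)
    (C^T *m std3 R *m D^T) (C^T *m A *m C)
  = C^T *m avg (std1 R) (std2 R) (std3 R) A *m C.
Proof. by have := avg_conj (std1 R) (std2 R) (std3 R) A DC; rewrite trmxK. Qed.

Lemma Jmx_quaternion : quaternion_triple (Jmx W k1) (Jmx W k2) (Jmx W k3).
Proof.
have [s1 s2 s3 s12] := std_quaternion R; have [-> -> ->] := JE.
have M A B : C^T *m A *m D^T *m (C^T *m B *m D^T) = C^T *m (A *m B) *m D^T.
  by rewrite !mulmxA -[_ *m D^T *m C^T]mulmxA DC mulmx1.
have CD : C^T *m D^T = 1%:M by rewrite -trmx_mul mulVmx // trmx1.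
split; rewrite M.
- by rewrite s1 mulmxN mulmx1 mulNmx CD.
- by rewrite s2 mulmxN mulmx1 mulNmx CD.
- by rewrite s3 mulmxN mulmx1 mulNmx CD.
by rewrite s12 mulmxN mulNmx.
Qed.

Lemma form_anti k : (W k)^T = - W k.
Proof.
have [_ w1 w2 w3] := some_coframeP.
have tD A B : (A + B : 'M[R]_4)^T = A^T + B^T by rewrite linearD.
have -> : k = k1 \/ k = k2 \/ k = k3 -> (W k)^T = - W k.
  by move=> [->|[->|->]]; rewrite ?w1 ?w2 ?w3 tD !wedge_anti -opprD.
by [].
by case: k => [[|[|[|//]]] lt3]; [left|right; left|right; right]; apply: val_inj.
Qed.

Lemma asd_proj_avg A : A^T = - A ->
  asd_proj W A = avg (Jmx W k1) (Jmx W k2) (Jmx W k3) A.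
Proof.
move=> A_anti; pose A' := D^T *m A *m D.
have AE : A = C^T *m A' *m C.
  by rewrite /A' !mulmxA -trmx_mul mulVmx // trmx1 mul1mx mulmxKV.
have A'_anti : A'^T = - A'.
  by rewrite /A' !trmx_mul trmxK A_anti mulNmx mulmxN mulmxA.
clearbody A'.
have hodgeE : hodge W A = C^T *m star A' *m C.
  apply/matrixP => k l; rewrite mxE.
  have -> : invmx (metric W) *m A *m (invmx (metric W))^T = D *m A' *m D^T.
    rewrite inv_metric trmx_mul trmxK AE !mulmxA.
    rewrite -[D *m D^T *m C^T]mulmxA DC mulmx1 mulmxK //.
  under eq_bigr => i _ do under eq_bigr => j _ do
    rewrite /volume det_columns_star -/C.
  rewrite sum_entries_trace; set S := star (wedge _ _).
  have -> : \tr (D *m A' *m D^T *m (C^T *m S *m C)^T) = \tr (A' *m S^T).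
    rewrite !trmx_mul trmxK !mulmxA -[_ *m D^T *m C^T]mulmxA DC mulmx1.
    by rewrite mxtrace_mulC !mulmxA mulmxV // mul1mx.
  have star_anti : (star A')^T = - star A'.
    by rewrite star_tr A'_anti starN.
  rewrite -star_adjoint trace_wedge // mulKf; last by rewrite pnatr_eq0.
  have colT m : (row m C^T)^T = col m C by rewrite tr_row trmxK.
  rewrite colT -row_mul mxE [RHS]mxE; apply: eq_bigr => m _.
  by rewrite [row _ _ _ _]mxE [col _ _ _ _]mxE.
have [-> -> ->] := JE; rewrite {2}AE avgC.
rewrite /asd_proj hodgeE {1}AE -mulmxBl -mulmxBr /star opprB addrC subrK.
by rewrite -scalemxAr -scalemxAl scalerA mulVf ?scale1r // pnatr_eq0.
Qed.

Lemma inner2_trace A B : inner2 W A B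
  = 2^-1 * \tr (A *m (invmx (metric W) *m B *m (invmx (metric W))^T)^T).
Proof.
rewrite /inner2 -sum_entries_trace; congr (_ * _).
apply: eq_bigr => i _; apply: eq_bigr => j _.
rewrite !mxE mulr_sumr exchange_big /=; apply: eq_bigr => q _.
rewrite mxE mulr_suml mulr_sumr; apply: eq_bigr => p _.
rewrite mxE; ring.
Qed.

Lemma self_dual_part A : A^T = - A ->
  A - avg (Jmx W k1) (Jmx W k2) (Jmx W k3) A
    = (inner2 W A (W k1) / 2) *: W k1 + (inner2 W A (W k2) / 2) *: W k2
      + (inner2 W A (W k3) / 2) *: W k3.
Proof.
move=> A_anti; pose A' := D^T *m A *m D.
have AE : A = C^T *m A' *m C.
  by rewrite /A' !mulmxA -trmx_mul mulVmx // trmx1 mul1mx mulmxKV.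
have A'_anti : A'^T = - A'.
  by rewrite /A' !trmx_mul trmxK A_anti mulNmx mulmxN mulmxA.
clearbody A'.
have [w1 w2 w3] := coframe_std some_coframeP; rewrite -/C in w1 w2 w3.
have inE B : inner2 W A (C^T *m B *m C) / 2 = 4^-1 * \tr (A' *m B^T).
  rewrite inner2_trace inv_metric !trmx_mul !trmxK.
  rewrite mulrC mulrA -invfM -natrM; congr (_ * _).
  rewrite {1}AE !mulmxA mulmxK // -[_ *m D^T *m C^T]mulmxA DC mulmx1.
  by rewrite mulmxK // mxtrace_mulC !mulmxA DC mul1mx.
rewrite w1 w2 w3 !inE.
have [-> -> ->] := JE; rewrite {1 2}AE avgC.
rewrite -mulmxBl -mulmxBr std_self_dual_part //.
by rewrite !mulmxDr !mulmxDl -!scalemxAr -!scalemxAl.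
Qed.

End AdaptedCoframe.

(** * Algebra of the torsion two-forms at a point *)

Section QuaternionicAverage.
Variables (R : realType) (J1 J2 J3 : 'M[R]_4).
Hypothesis quatJ : quaternion_triple J1 J2 J3.
Implicit Types A B : 'M[R]_4.

Lemma avg_rot A : avg J2 J3 J1 A = avg J1 J2 J3 A.
Proof.
by rewrite /avg -!addrA; congr (_ *: (_ + _)); rewrite addrA addrC.
Qed.

Lemma avg_invariant A : J1 *m avg J1 J2 J3 A *m J1^T = avg J1 J2 J3 A.
Proof.
have [s1 _ _ s12] := quatJ.
have s13 := quaternion_rev (quaternion_rot (quaternion_rot quatJ)).
have E J : J1 *m (J *m A *m J^T) *m J1^T = (J1 *m J) *m A *m (J1 *m J)^T.
  by rewrite trmx_mul !mulmxA.
have N B : (- B) *m A *m (- B)^T = B *m A *m B^T.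
  by rewrite linearN /= mulmxN !mulNmx opprK.
rewrite /avg -scalemxAr -scalemxAl !mulmxDr !mulmxDl !E s1 s12 s13 !N.
rewrite trmx1 mulmx1 mul1mx; congr (_ *: _).
by rewrite [_ + A]addrC addrAC.
Qed.

Lemma avg_conj_self A : avg J1 J2 J3 (J1 *m A *m J1^T) = avg J1 J2 J3 A.
Proof.
have [s1 _ _ s12] := quatJ.
have s21 := quaternion_rev quatJ.
have [_ _ _ s31] := quaternion_rot (quaternion_rot quatJ).
have E J : J *m (J1 *m A *m J1^T) *m J^T = (J *m J1) *m A *m (J *m J1)^T.
  by rewrite trmx_mul !mulmxA.
have N B : (- B) *m A *m (- B)^T = B *m A *m B^T.
  by rewrite linearN /= mulmxN !mulNmx opprK.
rewrite /avg !E s1 s21 s31 !N.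
rewrite trmx1 mulmx1 mul1mx; congr (_ *: _).
by rewrite [_ + A]addrC addrAC.
Qed.

Lemma avgD A B : avg J1 J2 J3 (A + B) = avg J1 J2 J3 A + avg J1 J2 J3 B.
Proof.
rewrite /avg -scalerDr !mulmxDr !mulmxDl; congr (_ *: _).
by rewrite !addrA; mx_linear.
Qed.

Lemma avgZ c A : avg J1 J2 J3 (c *: A) = c *: avg J1 J2 J3 A.
Proof.
by rewrite /avg -!scalemxAr -!scalemxAl -!scalerDr !scalerA mulrC.
Qed.

Lemma avg_wedge (al be : 'rV[R]_4) :
  avg J1 J2 J3 (wedge (al *m J1^T) (be *m J1^T)) = avg J1 J2 J3 (wedge al be).
Proof. by rewrite wedge_mulmx trmxK avg_conj_self. Qed.

End QuaternionicAverage.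

Section TorsionTwoForm.
Variables (R : realType) (J1 J2 J3 : 'M[R]_4).
Hypothesis quatJ : quaternion_triple J1 J2 J3.
Variables (a1 a2 a3 : 'rV[R]_4) (D : 'M[R]_4).

(** Each wedge product is moved by a suitable J_l, which does not change its
average: by J_2 or J_3 for the terms with equal indices, by J_1 for
J_1 a_1 /\ J_2 a_3 ~ a_1 /\ J_3 a_3 and J_1 a_1 /\ J_3 a_2 ~ - a_1 /\ J_2 a_2. *)
Lemma avg_torsion_two_form :
  avg J1 J2 J3 (D
    + 4^-1 *: (wedge (a2 *m J2^T) (a3 *m J2^T) - wedge (a1 *m J1^T) (a3 *m J2^T)
               + wedge (a2 *m J2^T) a1)
    - 4^-1 *: (wedge (a1 *m J1^T) (a2 *m J3^T) + wedge (a3 *m J3^T) a1)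
    - (3 / 4) *: wedge (a3 *m J3^T) (a2 *m J3^T))
  = avg J1 J2 J3 (D + wedge a2 a3).
Proof.
have q2 := quaternion_rot quatJ; have q3 := quaternion_rot q2.
have [s1 _ _ s12] := quatJ; have s13 := quaternion_rev q3.
pose av := avg J1 J2 J3.
have avB A B : av (A - B) = av A - av B by rewrite /av avgD avgN.
have avD A B : av (A + B) = av A + av B by exact: avgD.
have avZ c A : av (c *: A) = c *: av A by exact: avgZ.
have J1J1 (al : 'rV[R]_4) : al *m J1^T *m J1^T = - al.
  by rewrite -mulmxA -trmx_mul s1 linearN /= trmx1 mulmxN mulmx1.
have J1J2 (al : 'rV[R]_4) : al *m J2^T *m J1^T = - (al *m J3^T).
  by rewrite -mulmxA -trmx_mul s12 linearN /= mulmxN.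
have J1J3 (al : 'rV[R]_4) : al *m J3^T *m J1^T = al *m J2^T.
  by rewrite -mulmxA -trmx_mul s13.
have trN (al : 'rV[R]_4) : (- al)^T = - al^T by rewrite linearN.
have wN (al be : 'rV[R]_4) : wedge (- al) (- be) = wedge al be.
  by rewrite /wedge !trN !(mulNmx, mulmxN) !opprK.
have wNr (al be : 'rV[R]_4) : wedge al (- be) = - wedge al be.
  by rewrite /wedge !trN !(mulNmx, mulmxN) -opprD.
have E22 : av (wedge (a2 *m J2^T) (a3 *m J2^T)) = av (wedge a2 a3).
  by rewrite /av -(avg_rot J1) avg_wedge // avg_rot.
have E33 : av (wedge (a3 *m J3^T) (a2 *m J3^T)) = - av (wedge a2 a3).
  rewrite /av -(avg_rot J1) -(avg_rot J2) avg_wedge // wedge_swap avgN.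
  by rewrite (avg_rot J2) (avg_rot J1).
have E12 : av (wedge (a1 *m J1^T) (a3 *m J2^T)) = av (wedge a1 (a3 *m J3^T)).
  by rewrite /av -(avg_wedge quatJ) J1J1 J1J2 wN.
have E13 : av (wedge (a1 *m J1^T) (a2 *m J3^T)) = - av (wedge a1 (a2 *m J2^T)).
  by rewrite /av -(avg_wedge quatJ) J1J1 J1J3 -avgN -wNr -[in RHS]wN opprK.
have av_linear c c' A X Y Z T V S :
    av (A + c *: (X - Y + Z) - c *: (T + V) - c' *: S)
    = av A + c *: (av X - av Y + av Z) - c *: (av T + av V) - c' *: av S.
  by rewrite !(avB, avD, avZ).
rewrite -/av av_linear E22 E33 E12 E13.
rewrite (wedge_swap a1) (wedge_swap a1 (a3 *m _)) /av !avgN -/av avD.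
move: (av D) (av (wedge a2 a3)) (av (wedge a1 (a3 *m J3^T)))
  (av (wedge a1 (a2 *m J2^T))) => X Y Z T.
by apply/matrixP => i j; rewrite !mxE; field.
Qed.

End TorsionTwoForm.

Section PointwiseDecomposition.
Variables (R : realType) (W : 'I_3 -> 'M[R]_4).
Hypothesis W_adapted : exists C, su2_coframe W C.
Implicit Types A B F : 'M[R]_4.

Let g := metric W.
Let J := Jmx W.
Let g_sym : g^T = g := adapted_metric_sym W.
Let g_unit : g \in unitmx := adapted_metric_unit W_adapted.

Lemma form_Jmx k : W k = J k *m g.
Proof. by rewrite /J /Jmx mulmxKV. Qed.

Lemma Jmx_skew k : (J k *m g)^T = - (J k *m g).
Proof. by rewrite -form_Jmx form_anti. Qed.

Lemma Jmx_tr k : (J k)^T = - (invmx g *m J k *m g).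
Proof.
have := Jmx_skew k; rewrite trmx_mul g_sym => e.
by rewrite -[LHS](mulKmx g_unit) e mulmxN mulmxA.
Qed.

(** Invariance of [B] says that it commutes with each J_l, up to transposition,
so all three properties come from how J_l commutes with J_i. *)
Lemma Pmap_in_Sigma0 i j k B :
    quaternion_triple (J i) (J j) (J k) ->
    (forall l : 'I_3, l != i -> l = j \/ l = k) ->
    B^T = - B -> (forall l, J l *m B *m (J l)^T = B) ->
  in_Sigma0 W i (Pmap W i B).
Proof.
move=> q ijk B_anti B_inv; have [si _ _ sij] := q.
have sji := quaternion_rev q.
have [_ _ _ ski] := quaternion_rot (quaternion_rot q).
have sik := quaternion_rev (quaternion_rot (quaternion_rot q)).
have anti (X Y : 'M[R]_4) : Y *m B *m Y^T = B -> Y *m X = - (X *m Y) ->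
    Y *m (X *m B) *m Y^T = - (X *m B).
  by move=> YB e; rewrite (mulmxA Y) e !mulNmx -!mulmxA (mulmxA Y) YB.
have sym (X : 'M[R]_4) : X *m B *m X^T = B -> X *m X = - 1%:M ->
    (X *m B)^T = X *m B /\ X *m (X *m B) *m X^T = X *m B.
  move=> XB e; split; last by rewrite -[in RHS]XB !mulmxA.
  rewrite trmx_mul B_anti mulNmx -{1}XB -!mulmxA -trmx_mul e linearN /= trmx1.
  by rewrite !mulmxN mulmx1 opprK.
have [symB invB] := sym _ (B_inv i) si.
rewrite /Pmap -/J; split => // l /ijk[->|->]; apply: anti => //.
- by rewrite sij sji opprK.
by rewrite ski sik.
Qed.

(** Conjugating by [J j] fixes [B] and [g] and changes the sign of [J i]. *)
Lemma trace_Pmap i j k B :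
    quaternion_triple (J i) (J j) (J k) -> (forall l, J l *m B *m (J l)^T = B) ->
  \tr (invmx g *m (J i *m B)) = 0.
Proof.
move=> q B_inv; have [_ sj _ sij] := q; have sji := quaternion_rev q.
have skj := quaternion_rev (quaternion_rot q).
have Jg : (J j)^T *m invmx g = - (invmx g *m J j).
  by rewrite Jmx_tr mulNmx mulmxK.
have flip (h X Y Z : 'M[R]_4) : Y *m B *m Y^T = B -> Y^T *m h = - (h *m Y) ->
    Y *m X = Z -> Z *m Y = X -> \tr (h *m (X *m B)) = - \tr (h *m (X *m B)).
  move=> YB Yh YX ZY; rewrite -{1}YB !mulmxA mxtrace_mulC !mulmxA Yh.
  by rewrite !mulNmx linearN /= -[h *m Y *m X]mulmxA YX -[h *m Z *m Y]mulmxA ZY.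
have := flip _ _ _ _ (B_inv j) Jg sji skj => e; lra.
Qed.

Lemma asd_proj_anti A : A^T = - A -> (asd_proj W A)^T = - asd_proj W A.
Proof.
by move=> A_anti; rewrite asd_proj_avg // avg_tr A_anti avgN.
Qed.

Lemma asd_proj_invariant l A : A^T = - A ->
  J l *m asd_proj W A *m (J l)^T = asd_proj W A.
Proof.
have q := Jmx_quaternion W_adapted; rewrite -/J in q.
have q2 := quaternion_rot q; have q3 := quaternion_rot q2.
move=> A_anti; rewrite asd_proj_avg // -/J.
have [->|[->|->]] : l = k1 \/ l = k2 \/ l = k3.
- by case: l => [[|[|[|//]]] lt3]; [left|right; left|right; right]; exact: val_inj.
- exact: avg_invariant.
- by rewrite -(avg_rot (J k1)) avg_invariant.
by rewrite -(avg_rot (J k1)) -(avg_rot (J k2)) avg_invariant.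
Qed.

Definition cyclic (i j k : 'I_3) : Prop :=
  [\/ (i, j, k) = (k1, k2, k3), (i, j, k) = (k2, k3, k1)
    | (i, j, k) = (k3, k1, k2)].

Lemma cyclic_quaternion i j k : cyclic i j k ->
  quaternion_triple (J i) (J j) (J k).
Proof.
have q := Jmx_quaternion W_adapted; rewrite -/J in q.
have q2 := quaternion_rot q; have q3 := quaternion_rot q2.
by case=> -[-> -> ->].
Qed.

Lemma cyclic_sum (V : nmodType) (f : 'I_3 -> V) i j k : cyclic i j k ->
  f k1 + f k2 + f k3 = f i + f j + f k.
Proof.
by case=> -[-> -> ->] //; [rewrite -addrA addrC|rewrite addrC addrA].
Qed.

Lemma cyclic_other i j k l : cyclic i j k -> l != i -> l = j \/ l = k.
Proof.
by case=> -[-> -> ->]; case: l => [[|[|[|//]]] lt3] //= _;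
  [left|right|right|left|left|right]; exact: val_inj.
Qed.

(** For l <> i the product J_i W_l is another of the three forms, up to sign,
and disappears from the symmetric part. *)
Lemma symmetric_part i j k F : cyclic i j k -> F^T = - F ->
  J i *m F + (J i *m F)^T = 2 *: (J i *m asd_proj W F) - inner2 W F (W i) *: g.
Proof.
move=> ijk F_anti; have q := cyclic_quaternion ijk.
have [si _ _ sij] := q.
have sik := quaternion_rev (quaternion_rot (quaternion_rot q)).
have asd_sym : (J i *m asd_proj W F)^T = J i *m asd_proj W F.
  have [//] := Pmap_in_Sigma0 q (fun l => @cyclic_other i j k l ijk)
    (asd_proj_anti F_anti) (fun l => asd_proj_invariant l F_anti).
pose f l := inner2 W F (W l) / 2.
have FE : F = asd_proj W F + (f i *: (J i *m g) + f j *: (J j *m g) + f k *: (J k *m g)).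
  rewrite -!form_Jmx -(cyclic_sum (fun l => f l *: W l) ijk) -self_dual_part //.
  by rewrite asd_proj_avg // addrC subrK.
have JF : J i *m F = J i *m asd_proj W F
    + (- (f i *: g) - f j *: (J k *m g) + f k *: (J j *m g)).
  have expand (X Y Z B h : 'M[R]_4) (a b c : R) :
      X *m X = - 1%:M -> X *m Y = - Z -> X *m Z = Y ->
      X *m (B + (a *: (X *m h) + b *: (Y *m h) + c *: (Z *m h)))
      = X *m B + (- (a *: h) - b *: (Z *m h) + c *: (Y *m h)).
    move=> XX XY XZ; rewrite !mulmxDr -!scalemxAr !mulmxA XX XY XZ.
    by rewrite !mulNmx mul1mx !scalerN.
  by rewrite {1}FE expand.
have JFT : (J i *m F)^T = J i *m asd_proj W F
    + (- (f i *: g) + f j *: (J k *m g) - f k *: (J j *m g)).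
  have tD A B : (A + B : 'M[R]_4)^T = A^T + B^T by rewrite linearD.
  have tN A : (- A : 'M[R]_4)^T = - A^T by rewrite linearN.
  have tZ c A : (c *: A : 'M[R]_4)^T = c *: A^T by rewrite linearZ.
  by rewrite JF !(tD, tN, tZ) asd_sym !Jmx_skew g_sym !scalerN opprK.
rewrite JFT JF; move: (J i *m asd_proj W F) (J k *m g) (J j *m g) => X Y Z.
have -> : inner2 W F (W i) = 2 * f i by rewrite /f mulrC divfK // pnatr_eq0.
by apply/matrixP => a b; rewrite !mxE; ring.
Qed.

Lemma ricci_decomposition (ric F1 F2 F3 : 'M[R]_4) :
    ric^T = ric -> F1^T = - F1 -> F2^T = - F2 -> F3^T = - F3 ->
    ric = - (F1 *m (J k1)^T + F2 *m (J k2)^T + F3 *m (J k3)^T) ->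
  ric = J k1 *m asd_proj W F1 + J k2 *m asd_proj W F2 + J k3 *m asd_proj W F3
    - ((inner2 W F1 (W k1) + inner2 W F2 (W k2) + inner2 W F3 (W k3)) / 2) *: g.
Proof.
move=> ric_sym F1_anti F2_anti F3_anti ricE.
have ricE' : ric = J k1 *m F1 + J k2 *m F2 + J k3 *m F3.
  have E k F : F^T = - F -> (F *m (J k)^T)^T = - (J k *m F).
    by move=> F_anti; rewrite trmx_mul trmxK F_anti mulmxN.
  have tD A B : (A + B : 'M[R]_4)^T = A^T + B^T by rewrite linearD.
  rewrite -ric_sym ricE linearN /= !tD !E //.
  by rewrite !opprD !opprK.
have c1 : cyclic k1 k2 k3 by constructor 1.
have c2 : cyclic k2 k3 k1 by constructor 2.
have c3 : cyclic k3 k1 k2 by constructor 3.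
have := congr1 (fun A => A + A^T) ricE'; rewrite /= ric_sym.
have tD A B : (A + B : 'M[R]_4)^T = A^T + B^T by rewrite linearD.
have regroup (A B C A' B' C' : 'M[R]_4) :
    A + B + C + (A' + B' + C') = (A + A') + (B + B') + (C + C').
  by rewrite addrACA [A + B + _]addrACA.
rewrite !tD regroup (symmetric_part c1) // (symmetric_part c2) //.
rewrite (symmetric_part c3) //.
move: (J k1 *m _) (J k2 *m _) (J k3 *m _) => X Y Z e.
apply: (@scalerI _ _ (2 : R)); first by rewrite pnatr_eq0.
rewrite scaler_nat mulr2n e.
by apply/matrixP => a b; rewrite !mxE; field.
Qed.

Lemma inner2_wedge i j k (al be : 'rV[R]_4) :
    quaternion_triple (J i) (J j) (J k) ->
  inner2 W (wedge al be) (W i) = inner1 W (Jform W j al) (Jform W k be).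
Proof.
move=> q; have [_ _ _ sjk] := quaternion_rot q.
have giT : (invmx g)^T = invmx g by rewrite trmx_inv g_sym.
rewrite inner2_trace -/g giT form_Jmx mulmxA mulmxK //.
have K_anti : (invmx g *m J i)^T = - (invmx g *m J i).
  by rewrite trmx_mul giT Jmx_tr mulNmx mulmxK.
rewrite -mxtrace_tr trmx_mul trmxK trace_wedge // mulKf ?pnatr_eq0 //.
have expand (X Y Z h : 'M[R]_4) : X^T *m h = - (h *m X) -> X *m Y = - Z ->
    al *m X^T *m h *m (be *m Y^T)^T = al *m (h *m Z) *m be^T.
  move=> Xh XY; rewrite trmx_mul trmxK -!mulmxA (mulmxA X^T) Xh mulNmx.
  by rewrite -(mulmxA h) (mulmxA X) XY mulNmx !mulmxN opprK.
rewrite /inner1 /Jform (expand _ _ (J i)) //.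
by rewrite Jmx_tr mulNmx mulmxK.
Qed.

End PointwiseDecomposition.

(** * The theorem *)

(** Raising an index with [g], which the curvature annihilates, turns its action
on a 2-form into the commutator with the corresponding endomorphism. *)
Lemma commutator_of_form_curvature (R : realType) (g Rm P X : 'M[R]_4) :
    g \in unitmx -> Rm *m g + g *m Rm^T = 0 -> Rm *m P + P *m Rm^T = X ->
  Rm *m (P *m invmx g) - P *m invmx g *m Rm = X *m invmx g.
Proof.
move=> gu skew <-.
have e : Rm^T *m invmx g = - (invmx g *m Rm).
  rewrite -[Rm^T](mulKmx gu); move/eqP: skew; rewrite addrC addr_eq0 => /eqP ->.
  by rewrite mulmxN mulNmx mulmxA mulmxK.
by rewrite mulmxDl -[P *m _ *m invmx g]mulmxA e mulmxN !mulmxA.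
Qed.

Lemma ext_deriv_anti (R : realType) (al : 'rV[R]_4 -> 'rV[R]_4) x :
  (ext_deriv al x)^T = - ext_deriv al x.
Proof. by apply/matrixP => i j; rewrite !mxE opprB. Qed.

Section AdaptedPoint.
Variables (R : realType) (w : 'I_3 -> 'rV[R]_4 -> 'M[R]_4).
Variables (a : 'I_3 -> 'rV[R]_4 -> 'rV[R]_4) (x : 'rV[R]_4).
Let W k := w k x.
Hypothesis W_adapted : exists C, su2_coframe W C.

(** The entry F_i of the curvature matrix of the bundle of self-dual forms. *)
Definition curvature_form (i j k : 'I_3) : 'M[R]_4 :=
  ext_deriv (a i) x + wedge (a j x) (a k x).

Lemma curvature_form_anti i j k :
  (curvature_form i j k)^T = - curvature_form i j k.
Proof.
by rewrite /curvature_form linearD /= ext_deriv_anti wedge_anti -opprD.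
Qed.

Lemma asd_proj_cyclic i j k (A : 'M[R]_4) : cyclic i j k -> A^T = - A ->
  asd_proj W A = avg (Jmx W i) (Jmx W j) (Jmx W k) A.
Proof.
by move=> c A_anti; rewrite asd_proj_avg //; case: c => -[-> -> ->] //;
  rewrite ?(avg_rot (Jmx W k1)) // (avg_rot (Jmx W k2)) (avg_rot (Jmx W k1)).
Qed.

Lemma Phi_anti i j k : (Phi w a i j k x)^T = - Phi w a i j k x.
Proof.
have antiD (A B : 'M[R]_4) : A^T = - A -> B^T = - B -> (A + B)^T = - (A + B).
  by move=> eA eB; rewrite linearD /= eA eB -opprD.
have antiZ r (A : 'M[R]_4) : A^T = - A -> (r *: A)^T = - (r *: A).
  by move=> eA; rewrite linearZ /= eA scalerN.
have antiB (A B : 'M[R]_4) : A^T = - A -> B^T = - B -> (A - B)^T = - (A - B).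
  by move=> eA eB; rewrite linearB /= eA eB -opprD.
have an := @wedge_anti R.
apply: (antiB _ _ _ (antiZ _ _ (an _ _))).
apply: (antiB _ _ _ (antiZ _ _ (antiD _ _ (an _ _) (an _ _)))).
apply: (antiD _ _ (ext_deriv_anti _ _)).
exact: (antiZ _ _ (antiD _ _ (antiB _ _ (an _ _) (an _ _)) (an _ _))).
Qed.

Lemma asd_proj_Phi i j k : cyclic i j k ->
  asd_proj W (Phi w a i j k x) = asd_proj W (curvature_form i j k).
Proof.
move=> c; have q := cyclic_quaternion W_adapted c.
rewrite !(asd_proj_cyclic c) ?Phi_anti ?curvature_form_anti //.
exact: (avg_torsion_two_form q).
Qed.

Lemma Ric0_partE i j k : cyclic i j k ->
  Ric0_part w a i j k x = Jmx W i *m asd_proj W (curvature_form i j k).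
Proof. by move=> c; rewrite -asd_proj_Phi. Qed.

Lemma Ric0_part_in_Sigma0 i j k : cyclic i j k ->
  in_Sigma0 W i (Ric0_part w a i j k x).
Proof.
move=> c; have F_anti := curvature_form_anti i j k.
rewrite Ric0_partE //.
apply: (Pmap_in_Sigma0 (cyclic_quaternion W_adapted c)).
- by move=> l; exact: cyclic_other.
- exact: asd_proj_anti.
by move=> l; exact: asd_proj_invariant.
Qed.

Lemma inner2D (A B C : 'M[R]_4) : inner2 W (A + B) C = inner2 W A C + inner2 W B C.
Proof. by rewrite !inner2_trace mulmxDl linearD /= mulrDr. Qed.

(** By [trace_Pmap] the terms with [asd_proj] in [ricci_decomposition] form the
traceless part. *)
Lemma ricci_split (ric := ricci (metric_field w) x) :
    ric^T = ric ->
    ric = - (curvature_form k1 k2 k3 *m (Jmx W k1)^T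
             + curvature_form k2 k3 k1 *m (Jmx W k2)^T
             + curvature_form k3 k1 k2 *m (Jmx W k3)^T) ->
  ricci0 (metric_field w) x = Ric0_part w a k1 k2 k3 x
    + Ric0_part w a k2 k3 k1 x + Ric0_part w a k3 k1 k2 x
  /\ scal (metric_field w) x = - 2 *
    (inner2 W (curvature_form k1 k2 k3) (W k1)
     + inner2 W (curvature_form k2 k3 k1) (W k2)
     + inner2 W (curvature_form k3 k1 k2) (W k3)).
Proof.
move=> ric_sym ricE.
have c1 : cyclic k1 k2 k3 by constructor 1.
have c2 : cyclic k2 k3 k1 by constructor 2.
have c3 : cyclic k3 k1 k2 by constructor 3.
have a1 := curvature_form_anti k1 k2 k3.
have a2 := curvature_form_anti k2 k3 k1.
have a3 := curvature_form_anti k3 k1 k2.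
have := ricci_decomposition W_adapted ric_sym a1 a2 a3 ricE.
set s := inner2 _ _ _ + _ + _ => dec.
have scalE : scal (metric_field w) x = - 2 * s.
  rewrite /scal sum_entries_trace -/ric ric_sym dec mulmxBr !mulmxDr.
  have tr0 i j k : cyclic i j k -> \tr (invmx (metric_field w x) *m
      (Jmx W i *m asd_proj W (curvature_form i j k))) = 0.
    move=> c; apply: (trace_Pmap W_adapted (cyclic_quaternion W_adapted c)) => l.
    by apply: asd_proj_invariant => //; exact: curvature_form_anti.
  have trL (X Y Z T : 'M[R]_4) : \tr (X + Y + Z - T) = \tr X + \tr Y + \tr Z - \tr T.
    by rewrite linearB /= linearD /= linearD.
  have trg : \tr (invmx (metric W) *m ((s / 2) *: metric W)) = s / 2 * 4.
    rewrite -scalemxAr mulVmx; last exact: adapted_metric_unit.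
    by rewrite mxtraceZ mxtrace1.
  have e := congr2 +%R (congr2 +%R (tr0 _ _ _ c1) (tr0 _ _ _ c2)) (tr0 _ _ _ c3).
  apply: (etrans (trL _ _ _ _)); apply: (etrans (congr2 (fun p q => p - q) e trg)).
  by field.
split=> //; rewrite /ricci0 scalE -/ric dec !Ric0_partE //.
rewrite -/(metric_field w x) -addrA -opprD -scalerDl.
have -> : s / 2 + - 2 * s / 4 = 0 by field.
by rewrite scale0r; exact: subr0.
Qed.

Lemma scalar_torsion_terms :
  inner2 W (curvature_form k1 k2 k3) (W k1)
     + inner2 W (curvature_form k2 k3 k1) (W k2)
     + inner2 W (curvature_form k3 k1 k2) (W k3)
  = \sum_(i < 3) inner2 W (ext_deriv (a i) x) (W i)
    + inner1 W (Jform W k1 (a k1 x)) (Jform W k2 (a k2 x))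
    + inner1 W (Jform W k1 (a k1 x)) (Jform W k3 (a k3 x))
    + inner1 W (Jform W k2 (a k2 x)) (Jform W k3 (a k3 x)).
Proof.
have c1 : cyclic k1 k2 k3 by constructor 1.
have c2 : cyclic k2 k3 k1 by constructor 2.
have c3 : cyclic k3 k1 k2 by constructor 3.
have inner1C al be : inner1 W al be = inner1 W be al.
  rewrite /inner1; set X := al *m _ *m _.
  have -> : X 0 0 = X^T 0 0 by rewrite [RHS]mxE.
  by rewrite /X !trmx_mul trmxK trmx_inv adapted_metric_sym mulmxA.
have split_form i j k : cyclic i j k ->
    inner2 W (curvature_form i j k) (W i) = inner2 W (ext_deriv (a i) x) (W i)
      + inner1 W (Jform W j (a j x)) (Jform W k (a k x)).
  move=> c; rewrite /curvature_form inner2D; congr (_ + _).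
  exact: (inner2_wedge W_adapted _ _ (cyclic_quaternion W_adapted c)).
rewrite (split_form _ _ _ c1) (split_form _ _ _ c2) (split_form _ _ _ c3).
rewrite (inner1C (Jform W k3 _)).
have -> (f : 'I_3 -> R) : \sum_i f i = f k1 + f k2 + f k3.
  rewrite !big_ord_recl big_ord0 addr0 addrA.
  by congr (f _ + f _ + f _); exact: val_inj.
ring.
Qed.

End AdaptedPoint.

Theorem proposition4p4 (R : realType) (M : smooth_manifold R 4)
    (M_connected : connected [set: M]) (M_oriented : oriented M)
    (w : 'I_3 -> two_form M) (w_su2 : su2_structure w)
    (a : 'I_3 -> one_form M) (a_torsion : torsion_forms w a)
    (c : chart_index M) (x : 'rV[R]_4) (x_in : cimg (atlas c) x) :
  let wc := fun i : 'I_3 => w i c in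
  let ac := fun i : 'I_3 => a i c in
  let W := fun i : 'I_3 => w i c x in
  let J := fun (i : 'I_3) => Jform W i (a i c x) in
  [/\ ricci0 (metric_field wc) x
        = Ric0_part wc ac k1 k2 k3 x + Ric0_part wc ac k2 k3 k1 x
          + Ric0_part wc ac k3 k1 k2 x,
      [/\ in_Sigma0 W k1 (Ric0_part wc ac k1 k2 k3 x),
          in_Sigma0 W k2 (Ric0_part wc ac k2 k3 k1 x)
        & in_Sigma0 W k3 (Ric0_part wc ac k3 k1 k2 x)]
    & scal (metric_field wc) x
        = - 2 * (\sum_(i < 3) inner2 W (ext_deriv (ac i) x) (w i c x)
                 + inner1 W (J k1) (J k2) + inner1 W (J k1) (J k3)
                 + inner1 W (J k2) (J k3))].
Proof.
move=> wc ac W J.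
have [U [E [oU Ux UD sE cofE]]] := w_su2 c x x_in.
pose g := metric_field wc.
have adapted y : U y -> exists C, su2_coframe (fun i => wc i y) C.
  by move=> Uy; exists (E y); exact: cofE.
have W_adapted := adapted x Ux.
have gE y : U y -> (E y)^T *m E y = g y.
  by move=> Uy; rewrite /g /metric_field (metric_coframe (adapted y Uy) (cofE y Uy)).
have g_C2 : mx_C2 U g.
  apply: (eq_on_mx_C2 oU gE); have E_C2 := smooth_on_C2 oU (@subset_refl _ U) sE.
  by apply: mx_C2M => //; exact: mx_C2T.
have g_sym y : U y -> (g y)^T = g y by move=> _; exact: adapted_metric_sym.
have g_unit y : U y -> g y \in unitmx.
  by move=> Uy; exact: (adapted_metric_unit (adapted y Uy)).
have w_C2 k : mx_C2 U (wc k) by exact: (smooth_on_C2 oU UD (@two_smooth _ _ _ (w k) c)).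
have dw k : mx_diff (wc k) x by have [] := w_C2 k x Ux.
have da k : mx_diff (ac k) x.
  by apply: mx_diff_of_differentiable; exact: (@one_smooth _ _ _ (a k) c [::] x x_in).
have dG k : mx_diff (conn g k) x by exact: (conn_diff oU g_C2 g_sym g_unit k Ux).
have pairE (al : 'rV[R]_4) l : pairing al (delta_mx 0 l) = al 0 l.
  by rewrite /pairing -rowE !mxE.
have covw y l : U y ->
    [/\ covd (conn g) l (wc k1) y = ac k3 y 0 l *: wc k2 y - ac k2 y 0 l *: wc k3 y,
        covd (conn g) l (wc k2) y = ac k1 y 0 l *: wc k3 y - ac k3 y 0 l *: wc k1 y
      & covd (conn g) l (wc k3) y = ac k2 y 0 l *: wc k1 y - ac k1 y 0 l *: wc k2 y].
  move=> Uy; have [e1 e2 e3] := a_torsion c y (UD _ Uy) (delta_mx 0 l).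
  by rewrite -!nabla_covd /g e1 e2 e3 !pairE.
pose Rm i j := curv (conn g) i j x.
pose F := curvature_form ac x.
have cur1 i j : Rm i j *m W k1 + W k1 *m (Rm i j)^T
    = F k2 k3 k1 i j *: W k3 - F k3 k1 k2 i j *: W k2.
  apply: (curvature_of_rotating_form (P := wc k1) (Q := wc k2) (S := wc k3)
    (p := ac k1) (q := ac k2) (r := ac k3) oU Ux) => // [y l Uy|l|l].
  - by have [] := covw y l Uy.
  - by have [] := covw x l Ux.
  by have [] := covw x l Ux.
have cur2 i j : Rm i j *m W k2 + W k2 *m (Rm i j)^T
    = F k3 k1 k2 i j *: W k1 - F k1 k2 k3 i j *: W k3.
  apply: (curvature_of_rotating_form (P := wc k2) (Q := wc k3) (S := wc k1)
    (p := ac k2) (q := ac k3) (r := ac k1) oU Ux) => // [y l Uy|l|l].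
  - by have [] := covw y l Uy.
  - by have [] := covw x l Ux.
  by have [] := covw x l Ux.
have skew i j : Rm i j *m g x + g x *m (Rm i j)^T = 0 by exact: (curv_metric_skew oU g_C2 g_sym g_unit i j Ux).
have q := Jmx_quaternion W_adapted.
have com i j k l m (s t : R) :
    Rm i j *m W k + W k *m (Rm i j)^T = s *: W l - t *: W m ->
    Rm i j *m Jmx W k - Jmx W k *m Rm i j = s *: Jmx W l - t *: Jmx W m.
  move=> e; rewrite /Jmx (commutator_of_form_curvature (g_unit x Ux) (skew i j) e).
  by rewrite mulmxBl -!scalemxAl.
have Rm_anti i j : Rm j i = - Rm i j by exact: curv_anti.
have bianchi i j k l : Rm i j k l + Rm j k i l + Rm k i j l = 0.
  exact: (first_bianchi oU g_sym).
have ricE := ricci_of_quaternionic_curvature (g_sym x Ux) (g_unit x Ux) Rm_anti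
  bianchi skew q (Jmx_skew W_adapted k1) (curvature_form_anti _ _ _ _ _)
  (curvature_form_anti _ _ _ _ _) (fun i j => com _ _ _ _ _ _ _ (cur1 i j))
  (fun i j => com _ _ _ _ _ _ _ (cur2 i j)).
have ric_sym := ricci_contraction_sym (g_sym x Ux) (g_unit x Ux) Rm_anti bianchi skew.
rewrite -(ricci_curv g x) in ricE ric_sym.
have [ric0E scalE] := ricci_split W_adapted ric_sym ricE.
split=> //.
- by split; apply: Ric0_part_in_Sigma0 => //; [constructor 1|constructor 2|constructor 3].
rewrite scalE; congr (_ * _); exact: (scalar_torsion_terms ac W_adapted).
Qed.
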